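(* Let $\mathbb{K}$ be a field, let $n,d,k\in\mathbb{N}$, and let $S_{n,d,k}=\bigoplus_{i\ge 0}S_{k+id}$ be the Veronese module, regarded as an $R$-module. Then $S_{n,d,k}$ is Cohen-Macaulay if and only if $k<d$. Moreover, if $S_{n,d,k}$ is not Cohen-Macaulay, then it has maximal projective dimension, namely $\operatorname{pdim} S_{n,d,k}=N-1=\binom{d+n-1}{d}-1$.
   Context: $S=\mathbb{K}[x_1,\dots,x_n]=\bigoplus_{i\ge0}S_i$ with the standard grading. $\mathcal{A}=\{(a_1,\dots,a_n)\in\mathbb{N}^n : \sum_i a_i=d\}=\{\mathbf{a}_1,\dots,\mathbf{a}_N\}$ with $N=\binom{d+n-1}{d}$. $R=\mathbb{K}[y_1,\dots,y_N]$ acts on $S$ via the $\mathbb{K}$-algebra map $y_i\mapsto\mathbf{x}^{\mathbf{a}_i}$, whose image is the Veronese subring $S^{(d)}=\bigoplus_{i\ge0}S_{id}$; $S_{n,d,k}$ is a graded $R$-module through this map. $\operatorname{pdim}$ denotes projective dimension over $R$ (length of the minimal graded free resolution). ''Maximal'' refers to the general bounds $N-n\le\operatorname{pdim} S_{n,d,k}\le N-1$.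
   Formalization: The formal theorem assumes n ≥ 2 and d ≥ 1: for n = 1 the module S_{1,d,k} = x^k K[x^d] is free over R = K[y_1], hence Cohen-Macaulay for every k, so the stated equivalence fails; d = 0 and n = 0 are degenerate. *)

(* Defs.v *)
From HB Require Import structures.
From mathcomp Require Import all_boot all_order all_algebra.
From mathcomp Require Import mpoly.

Set Implicit Arguments.
Unset Strict Implicit.
Unset Printing Implicit Defensive.

Import GRing.Theory.
Local Open Scope ring_scope.

Section Modules.
Context (R : comNzRingType) (V : lmodType R).

Definition in_annihilator (f : R) : Prop := forall x : V, f *: x = 0.

(* A chain P_0 < ... < P_r of primes containing Ann V, i.e. a chain of primes
   of R / Ann V.  As in [ring_quotient], primes are boolean predicates, which
   is no restriction classically. *)
Definition is_support_chain r (P : 'I_r.+1 -> prime_idealr R) : Prop :=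
  (forall i f, in_annihilator f -> f \in P i) /\
  (forall i j : 'I_r.+1, (i < j)%N ->
     {subset P i <= P j} /\ exists2 f, f \in P j & f \notin P i).

Definition has_krull_dim (r : nat) : Prop :=
  (exists P : 'I_r.+1 -> prime_idealr R, is_support_chain P) /\
  (forall s (P : 'I_s.+1 -> prime_idealr R), is_support_chain P -> (s <= r)%N).

(* x lies in the submodule (s_0, s_1, ...) V *)
Definition in_ideal_mul (s : seq R) (x : V) : Prop :=
  exists y : 'I_(size s) -> V, x = \sum_(j < size s) s`_j *: y j.

Definition is_regular_seq (s : seq R) : Prop :=
  (forall i, (i < size s)%N -> forall x : V,
     in_ideal_mul (take i s) (s`_i *: x) -> in_ideal_mul (take i s) x) /\
  (exists x : V, ~ in_ideal_mul s x).

End Modules.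

Section GradedModules.
Context (K : fieldType) (N : nat) (V : lmodType {mpoly K[N]}).
Local Notation R := {mpoly K[N]}.

(* the ideal (y_1, ..., y_N) of R *)
Definition irrelevant (f : R) : Prop := f@_0%MM = 0.

Definition has_depth (r : nat) : Prop :=
  (exists s : seq R,
     [/\ forall f, f \in s -> irrelevant f, is_regular_seq V s & size s = r]) /\
  (forall s : seq R, (forall f, f \in s -> irrelevant f) ->
     is_regular_seq V s -> (size s <= r)%N).

Definition cohen_macaulay : Prop :=
  exists r, has_depth r /\ has_krull_dim V r.

(* 0 is homogeneous of every degree; for e < 0 it is the only such f. *)
Definition homog_of (e : int) (f : R) : Prop :=
  forall m, m \in msupp f -> (mdeg m)%:Z = e.

(* A sequence of graded free modules F_i with F_i = \bigoplus_j R(-shift i j)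
   and of degree-preserving maps F_i.+1 -> F_i, u |-> u *m diff i, on row
   vectors. *)
Record free_sequence := FreeSequence {
  rank : nat -> nat;
  shift : forall i, 'I_(rank i) -> int;
  diff : forall i, 'M[R]_(rank i.+1, rank i);
  diff_homog : forall i j l, homog_of (shift j - shift l) (diff i j l)
}.

Definition augmentation (F : free_sequence) (e : 'I_(rank F 0) -> V)
    (u : 'rV[R]_(rank F 0)) : V := \sum_(j < rank F 0) u 0 j *: e j.

(* [gr i] is the degree-i component of V, and [e j] is the image in V of the
   j-th basis vector of F_0. *)
Definition is_minimal_graded_free_resolution (gr : int -> V -> Prop)
    (F : free_sequence) (e : 'I_(rank F 0) -> V) : Prop :=
  [/\ forall j, gr (shift j) (e j),
      forall x : V, exists u, augmentation e u = x,
      forall u : 'rV_(rank F 0),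
        augmentation e u = 0 <-> exists v, u = v *m diff F 0,
      forall i (u : 'rV_(rank F i.+1)),
        u *m diff F i = 0 <-> exists v, u = v *m diff F i.+1
    & forall i j l, irrelevant (diff F i j l)].

Definition has_length (F : free_sequence) (p : nat) : Prop :=
  (0 < rank F p)%N /\ forall i, (p < i)%N -> rank F i = 0%N.

Definition has_pdim (gr : int -> V -> Prop) (p : nat) : Prop :=
  exists (F : free_sequence) (e : 'I_(rank F 0) -> V),
    is_minimal_graded_free_resolution gr e /\ has_length F p.

End GradedModules.

Definition nvars (n d : nat) : nat := 'C(d + n - 1, d).

(* An enumeration a_1, ..., a_N of the exponent vectors of total degree d *)
Record degree_enum (n d : nat) := DegreeEnum {
  expo :> 'I_(nvars n d) -> 'X_{1..n};
  expo_inj : injective expo;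
  mdeg_expo : forall i, mdeg (expo i) = d;
  expo_surj : forall m : 'X_{1..n}, mdeg m = d -> exists i, expo i = m
}.

Lemma degree_enum_inhabited n d : (0 < n)%N -> inhabited (degree_enum n d).
Proof.
case: n => // n _.
pose b := [seq s2m t | t : d.-tuple 'I_n.+1 <- enum (basis n.+1 d)].
have szb : size b = nvars n.+1 d by rewrite size_basis /nvars addnS subn1.
have lt_b (i : 'I_(nvars n.+1 d)) : (i < size b)%N by rewrite szb.
constructor; apply: (@DegreeEnum _ _ (fun i => nth 0%MM b i)).
- move=> i j /eqP; rewrite nth_uniq ?lt_b ?uniq_basis // => /eqP.
  exact: val_inj.
- by move=> i; apply/eqP; rewrite basis_cover mem_nth.
- move=> m /eqP; rewrite basis_cover -/b => mb.
  have lt_m : (index m b < nvars n.+1 d)%N by rewrite -szb index_mem.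
  by exists (Ordinal lt_m); rewrite nth_index.
Qed.

Section VeroneseType.
Context (K : fieldType) (n d k : nat).
Local Notation S := {mpoly K[n]}.

(* the direct sum of the S_{k + i d} inside S *)
Definition veronese_pred : {pred S} :=
  fun p => all (fun m => (k <= mdeg m)%N && (d %| mdeg m - k)%N) (msupp p).

Lemma veronese_predP (p : S) :
  reflect (forall m, p@_m != 0 -> exists i, mdeg m = (k + i * d)%N)
          (p \in veronese_pred).
Proof.
apply: (iffP allP) => H m.
- rewrite -mcoeff_msupp => /H /andP[le_k /dvdnP[i Ei]].
  by exists i; rewrite -Ei subnKC.
- rewrite mcoeff_msupp => /H[i ->]; rewrite leq_addr addKn.
  exact: dvdn_mull.
Qed.

Fact veronese_zmod_closed : zmod_closed veronese_pred.
Proof.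
split=> [|p q /veronese_predP Hp /veronese_predP Hq].
  by apply/veronese_predP => m; rewrite mcoeff0 eqxx.
apply/veronese_predP => m; rewrite mcoeffB => nz.
have [p0|/Hp //] := eqVneq p@_m 0.
by apply: Hq; apply: contraNneq nz => ->; rewrite p0 subrr.
Qed.

HB.instance Definition _ :=
  GRing.isZmodClosed.Build S veronese_pred veronese_zmod_closed.

Record veronese := Veronese {
  veronese_val :> S;
  _ : veronese_val \in veronese_pred
}.

HB.instance Definition _ := [isSub for veronese_val].
HB.instance Definition _ := [Choice of veronese by <:].
HB.instance Definition _ := [SubChoice_isSubZmodule of veronese by <:].

End VeroneseType.

Section VeroneseModule.
Context (K : fieldType) (n d k : nat) (a : degree_enum n d).
Local Notation S := {mpoly K[n]}.
Local Notation R := {mpoly K[nvars n d]}.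
Local Notation veronese := (veronese K n d k).

(* y_i |-> x^(a_i) *)
Definition veronese_map (f : R) : S := f \mPo [tuple 'X_[a i] | i < nvars n d].

Lemma veronese_map_supp (f : R) m :
  m \in msupp (veronese_map f) -> exists i, mdeg m = (i * d)%N.
Proof.
rewrite /veronese_map comp_mpolyEX mcoeff_msupp raddf_sum /= => nz.
have [/hasP[t _ /eqP Ht]|/hasPn H] :=
  boolP (has (fun t => mdeg m == mdeg t * d)%N (msupp f)).
  by exists (mdeg t).
case/eqP: nz; rewrite big_seq big1 // => t /H neq.
rewrite mcoeffZ comp_mpolyX.
rewrite (eq_bigr (fun i => 'X_[a i *+ t i])) => [|i _]; last first.
  by rewrite tnth_mktuple mpolyXn.
rewrite -(big_morph _ (@mpolyXD n K) (mpolyX0 n K)) mcoeffX.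
case: eqP => [Em|_]; last by rewrite mulr0.
case/eqP: neq; rewrite -Em mdeg_sum mdegE big_distrl /=.
by apply: eq_bigr => i _; rewrite mdegMn mdeg_expo mulnC.
Qed.

Lemma veronese_scale_closed (f : R) (x : veronese) :
  veronese_map f * x \in veronese_pred d k.
Proof.
case: x => p /= /veronese_predP Hp; apply/veronese_predP => m.
rewrite -mcoeff_msupp => /msuppM_le /allpairsP[[m1 m2] /= [m1f m2p ->]].
have [i Ei] := veronese_map_supp m1f.
have [|j Ej] := Hp m2; first by rewrite -mcoeff_msupp.
by exists (i + j)%N; rewrite mdegD Ei Ej mulnDl addnCA.
Qed.

Definition veronese_scale (f : R) (x : veronese) : veronese :=
  Veronese (veronese_scale_closed f x).

Fact veronese_scaleA (f g : R) (x : veronese) :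
  veronese_scale f (veronese_scale g x) = veronese_scale (f * g) x.
Proof. by apply: val_inj; rewrite /= mulrA /veronese_map rmorphM. Qed.

Fact veronese_scale1 : left_id 1 veronese_scale.
Proof. by move=> x; apply: val_inj; rewrite /= /veronese_map rmorph1 mul1r. Qed.

Fact veronese_scaleDr : right_distributive veronese_scale +%R.
Proof. by move=> f x y; apply: val_inj; rewrite /= mulrDr. Qed.

Fact veronese_scaleDl (x : veronese) :
  {morph veronese_scale^~ x : f g / f + g}.
Proof.
by move=> f g; apply: val_inj; rewrite /= /veronese_map rmorphD mulrDl.
Qed.

(* S_{n,d,k} as an R-module; the action of R depends on [a] *)
Definition veronese_module : Type := let _ := a in veronese.

HB.instance Definition _ := GRing.Zmodule.on veronese_module.
HB.instance Definition _ := GRing.Zmodule_isLmodule.Build R veronese_module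
  veronese_scaleA veronese_scale1 veronese_scaleDr veronese_scaleDl.

(* The degree-i component of the module is S_{k + i d}. *)
Definition veronese_gr (i : int) (x : veronese_module) : Prop :=
  forall m, m \in msupp (veronese_val x) -> (mdeg m)%:Z = k%:Z + i * d%:Z.

End VeroneseModule.

(* Main.v *)
From Stdlib Require Import Classical ClassicalEpsilon.
From HB Require Import structures.
Require Import Defs.
From mathcomp Require Import all_boot all_order all_algebra.
From mathcomp Require Import mpoly.

(** Write N for the number of variables y_i, phi for the map y_i |-> x^(a_i)
    and V for the Veronese module.

    Dimension and depth are both at most n for the same reason: n + 1 elements
    of S are algebraically dependent, and the lexicographically lowest terms of
    a polynomial relation are incompatible with a chain of n + 1 proper ideals
    J_i <= J_(i+1) whose successive members are separated by an element of
    J_(i+1) that is a nonzerodivisor modulo J_i.  Chains of primes and regular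
    sequences both give such chains.  Conversely the ideals
    phi^-1 (x_1, ..., x_i) show that the dimension is n, and x_1^d, ..., x_n^d
    is a regular sequence on V if k < d.

    If d <= k then z = x_1^(k - d) is not in V but f z is for every f without
    constant term.  For a regular sequence f, g, the identity g (f z) = f (g z)
    would give z in V, so the depth is at most 1 < n.

    As R is noetherian (Dickson's lemma), V has a minimal graded free
    resolution.  Reducing modulo one more variable keeps a complex of free
    modules exact except in the lowest degree where it was exact, so modulo all
    variables a minimal resolution of a torsion-free module is exact from degree
    N on, where it has zero differentials: its terms vanish there.  If d <= k,
    y_1 z spans a socle element of V / y_1 V; each further reduction moves the
    socle element up by one syzygy, and it finally shows F_(N-1) <> 0. *)

Set Implicit Arguments.
Unset Strict Implicit.
Unset Printing Implicit Defensive.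

Import Order.TTheory GRing.Theory.
Local Open Scope ring_scope.

(** * Induction over the ring operations of a polynomial ring *)

Section PolynomialInduction.
Context (K : fieldType) (n : nat).

Lemma mpoly_ring_ind (P : {mpoly K[n]} -> Prop) :
  (forall c, P c%:MP) -> (forall i, P 'X_i) ->
  (forall p q, P p -> P q -> P (p + q)) ->
  (forall p q, P p -> P q -> P (p * q)) ->
  forall p, P p.
Proof.
move=> PC PX PD PM p; have P0 : P 0 by rewrite -(mpolyC0 n).
have P1 : P 1 by rewrite -(mpolyC1 n).
rewrite [p]mpolyE; apply: (big_ind P P0 PD) => m _.
rewrite -mul_mpolyC mpolyXE_id; apply: (PM) => //.
apply: (big_ind P P1 PM) => i _; elim: (m i) => [|e IH]; first by rewrite expr0.
by rewrite exprS; apply: PM.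
Qed.

Lemma mpoly_rmorph_ext (A : comNzRingType) (f g : {rmorphism {mpoly K[n]} -> A}) :
  (forall c, f c%:MP = g c%:MP) -> (forall i, f 'X_i = g 'X_i) -> f =1 g.
Proof.
move=> eC eX; elim/mpoly_ring_ind => // p q ep eq.
  by rewrite !rmorphD ep eq.
by rewrite !rmorphM ep eq.
Qed.

End PolynomialInduction.

(** * Reduction modulo an initial segment of the variables *)

Section KillVariables.
Context (K : fieldType) (N : nat).
Local Notation R := {mpoly K[N]}.

(* The kernel of kill j is the ideal generated by the first j variables. *)
Definition kill (j : nat) (f : R) : R :=
  f \mPo [tuple if (i < j)%N then 0 else 'X_i | i < N].

HB.instance Definition _ j := GRing.RMorphism.copy (kill j)
  (comp_mpoly [tuple if (i < j)%N then 0 else 'X_i : R | i < N]).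

Lemma killC j c : kill j c%:MP = c%:MP.
Proof. exact: comp_mpolyC. Qed.

Lemma killX j i : kill j 'X_i = if (i < j)%N then 0 else 'X_i.
Proof. by rewrite /kill comp_mpolyXU -tnth_nth tnth_mktuple. Qed.

Lemma kill0 f : kill 0 f = f.
Proof. exact: comp_mpoly_id. Qed.

Lemma kill_kill i j f : kill i (kill j f) = kill (maxn i j) f.
Proof.
apply: (@mpoly_rmorph_ext _ _ _ (kill i \o kill j) (kill (maxn i j))).
  by move=> c /=; rewrite !killC.
move=> l /=; rewrite !killX leq_max orbC.
by case: (l < j)%N; rewrite ?rmorph0 ?killX.
Qed.

Lemma kill_division (j : 'I_N) f :
  exists g, kill j f = kill j.+1 f + 'X_j * kill j g.
Proof.
elim/mpoly_ring_ind: f => [c|i|p q [gp Ep] [gq Eq]|p q [gp Ep] [gq Eq]].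
- by exists 0; rewrite rmorph0 mulr0 addr0 !killC.
- have [<-|ne_ij] := eqVneq i j.
    by exists 1; rewrite rmorph1 mulr1 !killX ltnn leqnn add0r.
  exists 0; rewrite rmorph0 mulr0 addr0 !killX.
  by rewrite [(i < j.+1)%N]ltnS [(i <= j)%N]leq_eqVlt val_eqE (negPf ne_ij).
- by exists (gp + gq); rewrite !rmorphD /= Ep Eq mulrDr addrACA.
(* Modulo the first j variables, p = p' + X_j gp and q = q' + X_j gq give p q = p' q' + X_j (gp q +
   p' gq). *)
exists (gp * q + kill j.+1 p * gq).
rewrite rmorphD !rmorphM /=.
rewrite kill_kill (maxn_idPr (leqnSn j)).
move: Ep Eq; move: (kill j p) (kill j q) (kill j gp) (kill j gq) => u v g h Ep Eq.
rewrite {1}Ep mulrDl {1}Eq !mulrDr -addrA; congr (_ + _).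
by rewrite addrC -mulrA; congr (_ + _); rewrite mulrCA.
Qed.

Lemma kill_all f : kill N f = (f@_0%MM)%:MP.
Proof.
pose g : {rmorphism R -> R} := @mpolyC N K \o mcoeff 0%MM.
apply: (@mpoly_rmorph_ext _ _ _ (kill N) g) => [c|i] /=.
  by rewrite killC mcoeffC eqxx mulr1.
by rewrite killX ltn_ord mcoeffX mnm1_eq0 mpolyC0.
Qed.

Lemma kill_all_eq0 f : kill N f = 0 <-> irrelevant f.
Proof.
rewrite kill_all /irrelevant; split=> [/eqP|->]; last exact: mpolyC0.
by rewrite mpolyC_eq0 => /eqP.
Qed.

Lemma killS_eq0 j f : kill j f = 0 -> kill j.+1 f = 0.
Proof. by move=> E; rewrite -(maxn_idPl (leqnSn j)) -kill_kill E rmorph0. Qed.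

Lemma killS_X (j : 'I_N) : kill j.+1 'X_j = 0.
Proof. by rewrite killX leqnn. Qed.

Lemma kill_reg (j : 'I_N) f : kill j ('X_j * f) = 0 -> kill j f = 0.
Proof.
rewrite rmorphM /= killX ltnn => /eqP; rewrite mulf_eq0 => /orP[|/eqP //].
by rewrite -msize_poly_eq0 msizeX.
Qed.

Lemma killS_eq0E (j : 'I_N) f :
  kill j.+1 f = 0 -> exists g, kill j (f - 'X_j * g) = 0.
Proof.
move=> E; have [g Eg] := kill_division j f; exists g.
by rewrite rmorphB rmorphM /= killX ltnn Eg E add0r subrr.
Qed.

End KillVariables.

(** * Complexes of free modules reduced modulo a regular sequence *)

Section LengthOfResolutions.
(* Instantiated with R = K[X_1, ..., X_N], y_j = X_j and kl j = kill j; only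
   the fact that the y_j form a regular sequence, with kl j the reduction modulo
   the first j of them, is used. *)
Context (R : comNzRingType) (N : nat) (y : 'I_N -> R).
Context (kl : nat -> {rmorphism R -> R}).
Hypothesis kl0 : forall f, kl 0 f = 0 -> f = 0.
Hypothesis klS : forall j f, kl j f = 0 -> kl j.+1 f = 0.
Hypothesis klSy : forall j : 'I_N, kl j.+1 (y j) = 0.
Hypothesis kl_reg : forall (j : 'I_N) f, kl j (y j * f) = 0 -> kl j f = 0.
Hypothesis klSE : forall (j : 'I_N) f,
  kl j.+1 f = 0 -> exists g, kl j (f - y j * g) = 0.

Definition killed j m n (A : 'M[R]_(m, n)) : Prop := map_mx (kl j) A = 0.

Section KilledMatrices.
Context (j m n : nat).
Implicit Types A B : 'M[R]_(m, n).

Lemma killedP A : killed j A <-> forall a b, kl j (A a b) = 0.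
Proof.
split=> [/matrixP E a b|E]; first by have := E a b; rewrite !mxE.
by apply/matrixP => a b; rewrite !mxE.
Qed.

Lemma killedD A B : killed j A -> killed j B -> killed j (A + B).
Proof. by rewrite /killed map_mxD => -> ->; rewrite addr0. Qed.

Lemma killedN A : killed j A -> killed j (- A).
Proof. by rewrite /killed map_mxN => ->; rewrite oppr0. Qed.

Lemma killedB A B : killed j A -> killed j B -> killed j (A - B).
Proof. by move=> kA /killedN; apply: killedD. Qed.

Lemma killedZ c A : killed j A -> killed j (c *: A).
Proof. by rewrite /killed map_mxZ => ->; rewrite scaler0. Qed.

Lemma killedM p A (B : 'M_(n, p)) : killed j A -> killed j (A *m B).
Proof. by rewrite /killed map_mxM => ->; rewrite mul0mx. Qed.

End KilledMatrices.

Lemma killedS j m n (A : 'M[R]_(m, n)) : killed j A -> killed j.+1 A.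
Proof. by move=> /killedP kA; apply/killedP => a b; apply: klS. Qed.

Lemma killed0P m n (A : 'M[R]_(m, n)) : killed 0 A -> A = 0.
Proof. by move/killedP=> kA; apply/matrixP => a b; rewrite mxE; apply: kl0. Qed.

Lemma killed_y m n (j : 'I_N) (A : 'M[R]_(m, n)) : killed j.+1 (y j *: A).
Proof. by rewrite /killed map_mxZ klSy scale0r. Qed.

Lemma killed_reg m n (j : 'I_N) (A : 'M[R]_(m, n)) :
  killed j (y j *: A) -> killed j A.
Proof.
move/killedP=> kA; apply/killedP => a b; apply: kl_reg.
by have := kA a b; rewrite mxE.
Qed.

Lemma killedSE m n (j : 'I_N) (A : 'M[R]_(m, n)) :
  killed j.+1 A -> exists B, killed j (A - y j *: B).
Proof.
move=> /killedP kA.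
have [g Eg] := fin_all_exists (fun t : 'I_m * 'I_n => klSE (kA t.1 t.2)).
exists (\matrix_(a, b) g (a, b)); apply/killedP => a b.
by rewrite !mxE; apply: Eg (a, b).
Qed.

Context (rk : nat -> nat) (D : forall i, 'M[R]_(rk i.+1, rk i)).
Arguments D : clear implicits.

(** The index i refers to exactness at F_(i+1), the term of rank [rk i.+1]. Representatives over R
    replace the quotient ring. *)
Definition exact_mod j i : Prop := forall u : 'rV_(rk i.+1),
  killed j (u *m D i) -> exists v, killed j (u - v *m D i.+1).

(* The cokernel of D p, modulo the first j variables, has a nonzero element
   annihilated by the other variables. *)
Definition socle_mod j p : Prop := exists z : 'rV_(rk p),
  (forall v, ~ killed j (z - v *m D p)) /\
  forall l : 'I_N, (j <= l)%N -> exists v, killed j (y l *: z - v *m D p).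

Hypothesis DD : forall i, D i.+1 *m D i = 0.

(** If C is the complex modulo the first j elements, multiplication by y_j gives a short exact
    sequence 0 -> C -> C -> C / y_j C -> 0. In its long exact sequence the homology of C / y_j C at
    F_(i+2) lies between that of C at F_(i+2) and that of C at F_(i+1). *)
Lemma exact_modS (j : 'I_N) i :
  exact_mod j i -> exact_mod j i.+1 -> exact_mod j.+1 i.+1.
Proof.
move=> ex_i ex_Si u /killedSE[w].
move=> /[dup] /(killedM (D i)); rewrite mulmxBl -mulmxA DD mulmx0 sub0r.
rewrite -scalemxAl => /killedN; rewrite opprK => /killed_reg /ex_i[v kv] kw.
have [|t kt] := ex_Si (u - y j *: v).
  rewrite mulmxBl -scalemxAl -[u *m _](subrK (y j *: w)) -addrA -scalerBr.
  exact/killedD/killedZ.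
exists t; rewrite -[u](subrK (y j *: v)) addrAC.
by apply: killedD; [apply: killedS | apply: killed_y].
Qed.

(** The new socle element is w with w D_p = y_j z. If w were in the image of D_(p+1) modulo y_j,
    cancelling y_j in w D_p would put z in the image of D_p. If y_l z = w' D_p, then y_l w - y_j w'
    is a cycle, hence a boundary. *)
Lemma socle_modS (j : 'I_N) p :
  exact_mod j p -> socle_mod j p -> socle_mod j.+1 p.+1.
Proof.
move=> ex_p [z [z_nz z_soc]]; have [w kw] := z_soc j (leqnn j).
exists w; split=> [v /killedSE[t]|l lt_jl].
  move=> /(killedM (D p)); rewrite !mulmxBl -mulmxA DD mulmx0 subr0.
  rewrite -scalemxAl => /(killedD kw); rewrite addrA subrK -scalerBr.
  by move=> /killed_reg /z_nz.
have [w' kw'] := z_soc l (ltnW lt_jl).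
have [|v kv] := ex_p (y l *: w - y j *: w').
  rewrite mulmxBl -!scalemxAl.
  move: (killedB (killedZ (y j) kw') (killedZ (y l) kw)).
  rewrite !scalerBr !scalerA [y j * _]mulrC opprB addrC addrA subrK.
  by rewrite addrC.
exists v; rewrite -[y l *: w](subrK (y j *: w')) addrAC.
by apply: killedD; [apply: killedS | apply: killed_y].
Qed.

Hypothesis ex0 : forall i, exact_mod 0 i.
Hypothesis ex1 : exact_mod 1 0.

(** Each reduction may lose exactness in the lowest exact degree, except the first one, where [ex1]
    preserves it at F_1. Thus j + 1 reductions lose only j degrees. *)
Lemma exact_mod_leq j i : (j < N)%N -> (j <= i)%N -> exact_mod j.+1 i.
Proof.
elim: j i => [|j IH] [|i] lt_jN le_ji //.
  exact: (exact_modS (j := Ordinal lt_jN)).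
have lt_jN' := ltnW lt_jN.
by apply: (exact_modS (j := Ordinal lt_jN)); apply: IH => //; apply: leqW.
Qed.

Hypothesis N_gt0 : (0 < N)%N.

Lemma rank_eq0 p : (forall i, killed N (D i)) ->
  (N <= p)%N -> rk p = 0%N.
Proof.
move=> Dirr; case: p => [|p le_Np]; first by rewrite leqNgt N_gt0.
have kD i m (u : 'M_(m, _)) : killed N (u *m D i).
  by rewrite /killed map_mxM (Dirr i : map_mx _ _ = 0) mulmx0.
have exN : exact_mod N p.
  by rewrite -(prednK N_gt0); apply: exact_mod_leq; rewrite ?prednK // -ltnS prednK.
case E: (rk p.+1) => [//|r]; exfalso.
have j : 'I_(rk p.+1) by rewrite E; exact: ord0.
(* All maps vanish modulo the whole sequence, so every basis vector of F_(p+1) is a cycle, and by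
   exactness it would be zero there. *)
have [v kv] := exN (delta_mx 0 j) (kD _ _ _).
move/killedP/(_ 0 j): (killedD kv (kD p.+1 _ v)).
rewrite subrK mxE !eqxx rmorph1 => /eqP; by rewrite oner_eq0.
Qed.

(** Moving the socle element N - 1 times with [socle_modS] gives a nonzero class in a quotient of
    F_(N-1). *)
Lemma rank_gt0 : socle_mod 1 0 -> (0 < rk N.-1)%N.
Proof.
move=> soc1.
have socS j : (j < N)%N -> socle_mod j.+1 j.
  elim: j => [//|j IH] lt_jN; apply: (socle_modS (j := Ordinal lt_jN)).
    by apply: exact_mod_leq => //; apply: ltnW.
  exact/IH/ltnW.
have [|z [z_nz _]] := socS N.-1; first by rewrite prednK.
rewrite lt0n; apply/eqP => E; case: (z_nz 0).
by apply/matrixP => a b; exfalso; move: (b); rewrite E => -[].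
Qed.

End LengthOfResolutions.

(** * Dickson's lemma *)

Section Dickson.

(** Induction on the number k of coordinates. The type T is arbitrary so that e can be the leading
    exponent of an entry of a vector. *)
Lemma dickson (T : eqType) (e : T -> nat -> nat) k (P : T -> Prop) :
  exists s : seq T, (forall g, g \in s -> P g) /\
    forall f, P f -> exists2 g, g \in s & forall i, (i < k)%N -> (e g i <= e f i)%N.
Proof.
elim: k P => [|k IHk] P.
  have [[f Pf]|noP] := classic (exists f, P f).
    by exists [:: f]; split=> [g|g _]; [rewrite inE => /eqP-> | exists f; rewrite ?inE].
  by exists [::]; split=> // f Pf; case: noP; exists f.
have [s [sP s_dom]] := IHk P.
have slices H : exists t : seq T, (forall g, g \in t -> P g) /\
    forall f, P f -> (e f k < H)%N ->
    exists2 g, g \in t & forall i, (i < k.+1)%N -> (e g i <= e f i)%N.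
  elim: H => [|H [t [tP t_dom]]]; first by exists [::].
  have [t' [t'P t'_dom]] := IHk (fun f => P f /\ e f k = H).
  exists (t' ++ t); split=> [g|f Pf].
    by rewrite mem_cat => /orP[/t'P[]|/tP].
  rewrite ltnS leq_eqVlt => /orP[/eqP ef|ltH].
    have [g gt' g_le] := t'_dom f (conj Pf ef).
    exists g => [|i]; first by rewrite mem_cat gt'.
    rewrite ltnS leq_eqVlt => /orP[/eqP->|/g_le//].
    by rewrite ef (t'P g gt').2.
  have [g gt g_le] := t_dom f Pf ltH.
  by exists g => //; rewrite mem_cat gt orbT.
(* By the choice of H, an element with last coordinate at least H lies above some member of s. The
   others fall into finitely many slices of constant last coordinate. *)
pose H := \max_(g <- s) e g k; have [t [tP t_dom]] := slices H.
exists (s ++ t); split=> [g|f Pf]; first by rewrite mem_cat => /orP[/sP|/tP].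
have [/(t_dom f Pf)[g gt g_le]|leH] := ltnP (e f k) H.
  by exists g => //; rewrite mem_cat gt orbT.
have [g gs g_le] := s_dom f Pf; exists g => [|i]; first by rewrite mem_cat gs.
rewrite ltnS leq_eqVlt => /orP[/eqP->|/g_le//].
by apply: leq_trans leH; apply: (leq_bigmax_seq (F := fun g => e g k) _ gs).

Qed.

End Dickson.

(** * Submodules and spans of finite sequences *)

Section Submodules.
Context (R : comNzRingType) (V : lmodType R).

Definition submodule (Z : V -> Prop) : Prop :=
  Z 0 /\ forall c u v, Z u -> Z v -> Z (c *: u + v).

Fixpoint span (s : seq V) (x : V) : Prop :=
  if s is u :: s' then exists c, span s' (x - c *: u) else x = 0.

Lemma submoduleZ Z c u : submodule Z -> Z u -> Z (c *: u).
Proof. by move=> [Z0 ZD] Zu; rewrite -[_ *: _]addr0; apply: ZD. Qed.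

Lemma submoduleD Z u v : submodule Z -> Z u -> Z v -> Z (u + v).
Proof. by move=> [Z0 ZD] Zu Zv; rewrite -[u]scale1r; apply: ZD. Qed.

Lemma submodule_sum Z (I : Type) (r : seq I) (F : I -> V) :
  submodule Z -> (forall i, Z (F i)) -> Z (\sum_(i <- r) F i).
Proof.
move=> subZ ZF; apply: big_ind => [|u v|//]; first by case: subZ.
exact: submoduleD.
Qed.

Lemma span_submodule s : submodule (span s).
Proof.
elim: s => [|w s [IH0 IHD]] /=.
  by split=> // c u v -> ->; rewrite scaler0 addr0.
split=> [|c u v [a ua] [b vb]]; first by exists 0; rewrite scale0r subr0.
exists (c * a + b); rewrite scalerDl -scalerA opprD addrACA -scalerBr.
exact: IHD.
Qed.

Lemma span_mem s u : u \in s -> span s u.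
Proof.
elim: s => // w s IH; rewrite inE /= => /predU1P[->|/IH us].
  by exists 1; rewrite scale1r subrr; case: (span_submodule s).
by exists 0; rewrite scale0r subr0.
Qed.

Lemma span_min s Z x :
  submodule Z -> (forall u, u \in s -> Z u) -> span s x -> Z x.
Proof.
move=> subZ; elim: s x => [|w s IH] x sZ /=; first by move->; case: subZ.
move=> [c sx]; rewrite -[x](subrK (c *: w)); apply: (submoduleD subZ).
  by apply: IH sx => u us; apply: sZ; rewrite inE us orbT.
by apply: submoduleZ => //; apply: sZ; rewrite mem_head.
Qed.

Lemma span_sub s t x : {subset s <= t} -> span s x -> span t x.
Proof. by move=> st; apply: span_min (span_submodule t) _ => u /st /span_mem. Qed.

End Submodules.

(** * The basis theorem for submodules of free modules *)

Section Noetherian.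
Context (K : fieldType) (N : nat).
Local Notation R := {mpoly K[N]}.

Lemma mlead_reduce (p q : R) : p != 0 -> q != 0 -> (mlead q <= mlead p)%MM ->
  exists c : R, p - c * q = 0 \/ (mlead (p - c * q) < mlead p)%O.
Proof.
move=> p0 q0 le_qp; pose a := mleadc p / mleadc q.
have qc : mleadc q != 0 by rewrite mleadc_eq0.
have pc : mleadc p != 0 by rewrite mleadc_eq0.
pose m := (mlead p - mlead q)%MM; exists (a *: 'X_[m]).
have Em : (m + mlead q)%MM = mlead p by rewrite /m submK.
have lead : mlead (a *: 'X_[m] * q) = mlead p.
  rewrite -scalerAl mleadZ ?mulf_neq0 ?invr_neq0 //.
  by rewrite mleadM ?mleadXm ?Em // -msize_poly_eq0 msizeX.
have coef : (a *: 'X_[m] * q)@_(mlead p) = mleadc p.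
  have XqE : ('X_[m] * q)@_(m + mlead q) = mleadc q.
    by rewrite mulrC mcoeffMX.
  by rewrite -scalerAl mcoeffZ -[in LHS]Em XqE divfK.
have [E|nz] := eqVneq (p - a *: 'X_[m] * q) 0; [by left | right].
rewrite lt_neqAle; apply/andP; split.
  apply: contraNneq nz => E.
  by rewrite -mleadc_eq0 E mcoeffB coef subrr.
by have := mleadB_le p (a *: 'X_[m] * q); rewrite lead joinxx.
Qed.

(** A Groebner basis argument, by induction on the number c of last coordinates that may be nonzero.
    For the first such coordinate j, Dickson's lemma gives finitely many elements, one of whose
    leading monomials at j always divides the given one. Subtracting multiples of them lowers the
    leading monomial until coordinate j vanishes. *)
Lemma submodule_fg r (Z : 'rV[R]_r -> Prop) : submodule Z ->
  exists s, (forall u, u \in s -> Z u) /\ forall u, Z u -> span s u.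
Proof.
move=> subZ; suff H c : exists s, (forall u, u \in s -> Z u) /\ forall u, Z u ->
    (forall i : 'I_r, (i + c < r)%N -> u 0 i = 0) -> span s u.
  have [s [sZ s_gen]] := H r; exists s; split=> // u Zu; apply: s_gen => // i.
  by rewrite ltnNge leq_addl.
elim: c => [|c [s [sZ s_gen]]].
  exists [::]; split=> // u _ u0; apply/rowP => i.
  by rewrite mxE u0 // addn0.
have [le_rc|lt_cr] := leqP r c.
  exists s; split=> // u Zu _; apply: s_gen => // i.
  by rewrite ltnNge (leq_trans le_rc (leq_addl _ _)).
have lt_j : (r - c.+1 < r)%N by rewrite ltn_subrL (leq_ltn_trans _ lt_cr).
pose j := Ordinal lt_j.
have ltjE (i : 'I_r) : (i < j)%N = (i + c.+1 < r)%N by rewrite ltn_subRL addnC.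
pose lead (u : 'rV[R]_r) i := nth 0%N (mlead (u 0 j)) i.
have [t [tP t_dom]] := dickson lead N
  (fun u => [/\ Z u, forall i : 'I_r, (i < j)%N -> u 0 i = 0 & u 0 j != 0]).
exists (t ++ s); split=> [u|]; first by rewrite mem_cat => /orP[/tP[]|/sZ].
have zero u : Z u -> (forall i : 'I_r, (i < j)%N -> u 0 i = 0) -> u 0 j = 0 ->
    span (t ++ s) u.
  move=> Zu u0 uj; apply: (@span_sub _ _ s) => [v vs|].
    by rewrite mem_cat vs orbT.
  apply: s_gen => // i lt_i; have : (i <= j)%N.
    by rewrite leq_subRL // addnC addnS.
  rewrite leq_eqVlt => /orP[/eqP/val_inj->//|]; exact: u0.
move=> u Zu u0'; have {u0'}u0 (i : 'I_r) : (i < j)%N -> u 0 i = 0.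
  by rewrite ltjE; apply: u0'.
move: {2}(mlead (u 0 j)) (erefl (mlead (u 0 j))) => m.
elim/(@ltmwf N): m u Zu u0 => m IH u Zu u0 Em.
have [uj|uj] := eqVneq (u 0 j) 0; first exact: zero.
have [|g gt g_le] := t_dom u; first by split.
have [Zg g0 gj] := tP g gt.
have [|c' c'P] := mlead_reduce uj gj.
  by apply/mnm_lepP => i; rewrite !(mnm_nth 0%N); apply: g_le.
have Zu' : Z (u - c' *: g).
  by rewrite addrC -scaleNr; case: subZ => _; apply.
have u'0 (i : 'I_r) : (i < j)%N -> (u - c' *: g) 0 i = 0.
  by move=> lt_i; rewrite !mxE u0 // g0 // mulr0 subr0.
rewrite -[u](subrK (c' *: g)); apply: (submoduleD (span_submodule _)).
  case: c'P => [E|lt]; first by apply: zero => //; rewrite !mxE.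
  apply: (IH (mlead ((u - c' *: g) 0 j))) => //.
  by rewrite !mxE -Em.
apply: (submoduleZ _ (span_submodule _)); apply: span_mem.
by rewrite mem_cat gt.
Qed.

End Noetherian.

(** * Homogeneous components of polynomials *)

Section HomogeneousComponents.
Context (K : fieldType) (N : nat).
Local Notation R := {mpoly K[N]}.
Implicit Types (p q : R) (e b : int).

(** The degree is an integer because entries of graded maps have differences of shifts as
    degrees. *)
Definition hcomp e p : R :=
  if e is Posz d then pihomog (@mdeg N) d p else 0.

Lemma mcoeff_hcomp e p m :
  (hcomp e p)@_m = if (mdeg m)%:Z == e then p@_m else 0.
Proof.
case: e => [d|d] /=; last by rewrite mcoeff0.
rewrite pihomogE raddf_sum /= (eq_bigr (fun m' => p@_m' * (m' == m)%:R)); last first.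
  by move=> m' _; rewrite mcoeffZ mcoeffX.
have [mp|mp] := boolP (m \in msupp p); last first.
  rewrite (memN_msupp_eq0 mp) if_same big_seq_cond big1 // => m' /andP[m'p _].
  by rewrite (_ : (m' == m) = false) ?mulr0 //; apply: contraNF mp => /eqP<-.
rewrite -big_filter; case: ifP => /eqP; last first.
  move=> ne; rewrite big_seq_cond big1 // => m'; rewrite andbT mem_filter.
  move=> /andP[/eqP Em' _]; rewrite (_ : (m' == m) = false) ?mulr0 //.
  by apply/eqP => E; apply: ne; rewrite -E Em'.
move=> [Em]; rewrite (bigD1_seq m) ?filter_uniq ?msupp_uniq //=; last first.
  by rewrite mem_filter /= Em eqxx.
by rewrite eqxx mulr1 big1 ?addr0 // => m' /negPf->; rewrite mulr0.
Qed.

Fact hcomp_is_linear e : linear (hcomp e).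
Proof.
move=> c p q; apply/mpolyP => m; rewrite mcoeffD mcoeffZ !mcoeff_hcomp.
by case: ifP => _; rewrite ?mcoeffD ?mcoeffZ // mulr0 addr0.
Qed.
HB.instance Definition _ e :=
  GRing.isLinear.Build K R R _ (hcomp e) (hcomp_is_linear e).

Lemma hcomp_homog e p : homog_of e (hcomp e p).
Proof.
by move=> m; rewrite mcoeff_msupp mcoeff_hcomp; case: ifP => [/eqP //|_]; rewrite eqxx.
Qed.

Lemma homog_hcomp e p : homog_of e p -> hcomp e p = p.
Proof.
move=> hp; apply/mpolyP => m; rewrite mcoeff_hcomp; case: eqP => // ne.
apply/esym/eqP; apply: contraPT ne => nz; apply; apply: hp.
by rewrite mcoeff_msupp.
Qed.

Lemma hcompX e m : hcomp e 'X_[m] = if (mdeg m)%:Z == e then 'X_[m] else 0.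
Proof.
apply/mpolyP => m'; rewrite mcoeff_hcomp mcoeffX [RHS]fun_if mcoeffX mcoeff0.
have [<-|_] := eqVneq m m'; first by [].
by rewrite !if_same.
Qed.

Lemma hcompM e b p q : homog_of b q -> hcomp (e + b) (p * q) = hcomp e p * q.
Proof.
move=> hq; rewrite [p]mpolyE mulr_suml !raddf_sum mulr_suml.
apply: eq_bigr => m _ /=; rewrite {1}[q]mpolyE [in RHS](mpolyE q).
rewrite !mulr_sumr raddf_sum; apply: eq_big_seq => m' /hq <- /=.
rewrite -scalerAl -!scalerAr !linearZ /= -mpolyXD !hcompX mdegD PoszD.
rewrite (can_eq (addrK _)); case: ifP => _; last by rewrite !(scaler0, mul0r).
by rewrite mpolyXD -scalerAl !scalerA mulrC.
Qed.

Lemma irrelevant_hcomp0 p : hcomp 0 p = (p@_0%MM)%:MP.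
Proof.
apply/mpolyP => m; rewrite mcoeff_hcomp mcoeffC eqz_nat mdeg_eq0.
by case: eqP => [->|_]; rewrite ?mulr1 ?mulr0.
Qed.

End HomogeneousComponents.

(** * Minimal homogeneous generators of graded submodules *)

Section GradedSubmodules.
Context (K : fieldType) (N : nat).
Local Notation R := {mpoly K[N]}.

(* The degree-e component in the graded free module \bigoplus_j R(-s j). *)
Definition hvec r (s : 'I_r -> int) (e : int) (u : 'rV[R]_r) : 'rV[R]_r :=
  \row_j hcomp (e - s j) (u 0 j).

Definition homog_mx m n (s : 'I_m -> int) (t : 'I_n -> int) (D : 'M[R]_(m, n)) :=
  forall i l, homog_of (s i - t l) (D i l).

Lemma hvec_mul m n (s : 'I_m -> int) (t : 'I_n -> int) D e v :
  homog_mx s t D -> hvec t e (v *m D) = hvec s e v *m D.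
Proof.
move=> hD; apply/rowP => l; rewrite !mxE raddf_sum; apply: eq_bigr => i _.
by rewrite !mxE -(hcompM (e - s i) _ (hD i l)) addrA subrK.
Qed.

Definition graded r (s : 'I_r -> int) (Z : 'rV[R]_r -> Prop) : Prop :=
  forall e u, Z u -> Z (hvec s e u).

Lemma graded_ker m n (s : 'I_m -> int) (t : 'I_n -> int) (D : 'M[R]_(m, n)) :
  homog_mx s t D -> graded s (fun u => u *m D = 0).
Proof.
move=> hD e u uD; rewrite -(hvec_mul e _ hD) uD.
by apply/rowP => l; rewrite !mxE raddf0.
Qed.

Lemma sum_hvec r (s : 'I_r -> int) (u : 'rV[R]_r) :
  exists E : seq int, u = \sum_(e <- E) hvec s e u.
Proof.
pose E := undup (flatten [seq [seq (mdeg m)%:Z + s j | m <- msupp (u 0 j)]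
                         | j <- enum 'I_r]).
exists E; apply/rowP => j; apply/mpolyP => m.
rewrite summxE raddf_sum /=.
rewrite (eq_bigr (fun e => if (mdeg m)%:Z + s j == e then (u 0 j)@_m else 0)).
  have [mu|mu] := boolP (m \in msupp (u 0 j)); last first.
    by rewrite (memN_msupp_eq0 mu) big1 // => e _; rewrite if_same.
  rewrite (bigD1_seq ((mdeg m)%:Z + s j)) ?undup_uniq //=; last first.
    rewrite mem_undup; apply/flatten_mapP; exists j; first by rewrite mem_enum.
    by apply/mapP; exists m.
  by rewrite eqxx big1 ?addr0 // => e; rewrite eq_sym => /negPf->.
by move=> e _; rewrite mxE mcoeff_hcomp eq_sym subr_eq eq_sym.
Qed.

Definition homog_generators r (s : 'I_r -> int) (Z : 'rV[R]_r -> Prop) r'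
    (s' : 'I_r' -> int) (D : 'M[R]_(r', r)) : Prop :=
  homog_mx s' s D /\ forall u, Z u <-> exists v, u = v *m D.

Section Generators.
Context (r : nat) (s : 'I_r -> int) (Z : 'rV[R]_r -> Prop).
Hypotheses (subZ : submodule Z) (grZ : graded s Z).

(** The homogeneous components of finitely many generators lie in Z, as Z is graded, and finitely
    many of them generate it. *)
Lemma homog_generators_ex :
  exists r' (s' : 'I_r' -> int) D, homog_generators s Z s' D.
Proof.
have [g [gZ g_gen]] := submodule_fg subZ.
have [t [tZ t_hom t_gen]] : exists t : seq 'rV[R]_r, [/\
    forall u, u \in t -> Z u, forall u, u \in t -> exists e, hvec s e u = u
    & forall u, u \in g -> span t u].
  elim: g gZ {g_gen} => [|u g IH] gZ; first by exists [::].
  have [|t [tZ t_hom t_gen]] := IH; first by move=> v vg; apply: gZ; rewrite inE vg orbT.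
  have [E Eu] := sum_hvec s u.
  exists ([seq hvec s e u | e <- E] ++ t); split=> v.
  - rewrite mem_cat => /orP[/mapP[e _ ->]|/tZ//].
    by apply/grZ/gZ; rewrite mem_head.
  - rewrite mem_cat => /orP[/mapP[e _ ->]|/t_hom//]; exists e.
    by apply/rowP => j; rewrite !mxE homog_hcomp //; apply: hcomp_homog.
  rewrite inE => /predU1P[->|/t_gen]; last first.
    by apply: span_sub => w wt; rewrite mem_cat wt orbT.
  set t' := _ ++ t; rewrite Eu big_seq; apply: big_ind => [|x y|e eE].
  - by case: (span_submodule t').
  - exact: (submoduleD (span_submodule t')).
  by apply: span_mem; rewrite mem_cat; apply/orP; left; apply/mapP; exists e.
pose D := \matrix_(i < size t) t`_i.
have ex (i : 'I_(size t)) : exists e, hvec s e t`_i = t`_i.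
  by apply: t_hom; apply: mem_nth.
have [s' s'P] := fin_all_exists ex.
exists (size t), s', D; split=> [i l|u].
  by rewrite /D mxE -s'P mxE; apply: hcomp_homog.
split=> [/g_gen ug|[v ->]].
  pose im (x : 'rV[R]_r) := exists v, x = v *m D.
  have subim : submodule im.
    split=> [|c x y [v ->] [w ->]]; first by exists 0; rewrite mul0mx.
    by exists (c *: v + w); rewrite mulmxDl scalemxAl.
  apply: (span_min subim _ ug) => w /t_gen; apply: (span_min subim) => x xt.
  have lt_x : (index x t < size t)%N by rewrite index_mem.
  exists (delta_mx 0 (Ordinal lt_x)); rewrite -rowE rowK.
  by rewrite nth_index.
rewrite mulmx_sum_row; apply: submodule_sum => // i.
by apply: (submoduleZ _ subZ); rewrite rowK; apply/tZ/mem_nth.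
Qed.

(* The degree-(s' j) component of the relation can be solved for the j-th
   generator. *)
Lemma homog_generators_drop r' (s' : 'I_r'.+1 -> int) D (v : 'rV[R]_r'.+1) j :
  homog_generators s Z s' D -> v *m D = 0 -> ~ irrelevant (v 0 j) ->
  homog_generators s Z (s' \o lift j) (row' j D).
Proof.
move=> [hD genD] vD vj; split=> [i l|u]; first by rewrite mxE; apply: hD.
pose c := (v 0 j)@_0%MM; have c0 : c != 0 by apply/eqP.
pose w := hvec s' (s' j) v.
have wD : w *m D = 0 by apply: graded_ker hD _ _ vD.
have wj : w 0 j = c%:MP by rewrite mxE subrr irrelevant_hcomp0.
have mulE x : x *m D = x 0 j *: row j D + col' j x *m row' j D.
  rewrite !mulmx_sum_row (bigD1_ord j) //=; congr (_ + _).
  apply: eq_bigr => i _; rewrite mxE; congr (_ *: _).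
  by apply/rowP => l; rewrite !mxE.
have rowj : row j D = (- (c^-1)%:MP *: col' j w) *m row' j D.
  move: (mulE w); rewrite wD wj => /esym/eqP; rewrite addr_eq0 => /eqP E.
  rewrite -scalemxAl scaleNr -scalerN -E scalerA -mpolyCM mulVf //.
  by rewrite mpolyC1 scale1r.
rewrite genD; split=> [[x ->]|[x ->]].
  rewrite mulE rowj scalemxAl -mulmxDl; by eexists.
exists (\row_i if unlift j i is Some i' then x 0 i' else 0).
rewrite mulE mxE unlift_none scale0r add0r; congr (_ *m _).
by apply/rowP => i; rewrite !mxE liftK.
Qed.

(** A generator is dropped as long as some relation has an entry with nonzero constant term. This
    ends because the number of generators decreases. *)
Lemma minimal_generators : exists r' (s' : 'I_r' -> int) D,
  homog_generators s Z s' D /\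
  forall v : 'rV_r', v *m D = 0 -> forall j, irrelevant (v 0 j).
Proof.
have [r0 ex0] := homog_generators_ex.
elim/ltn_ind: r0 ex0 => r0 IH [s' [D genD]].
have [min|] := classic (forall v : 'rV_r0, v *m D = 0 -> forall j, irrelevant (v 0 j)).
  by exists r0, s', D.
move=> /not_all_ex_not[v nv].
have [vD /not_all_ex_not[j vj]] := imply_to_and _ _ nv => {nv}.
case: r0 => [|r0] in IH s' D genD v vD j vj *; first by case: j {vj}.
apply: (IH r0 (ltnSn r0)); exists (s' \o lift j), (row' j D).
exact: homog_generators_drop vD vj.
Qed.

End Generators.
End GradedSubmodules.

(** * Existence of minimal graded free resolutions *)

Section MinimalResolutions.
Context (K : fieldType) (N : nat).
Local Notation R := {mpoly K[N]}.

(* A graded free module with a graded submodule of the relations that remain to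
   be resolved. *)
Record stage := Stage {
  st_rank : nat;
  st_shift : 'I_st_rank -> int;
  st_rel : 'rV[R]_st_rank -> Prop;
  st_sub : submodule st_rel;
  st_graded : graded st_shift st_rel;
  st_irrelevant : forall u, st_rel u -> forall j, irrelevant (u 0 j)
}.

Record extension (X : stage) := Extension {
  ext_stage : stage;
  ext_mx : 'M[R]_(st_rank ext_stage, st_rank X);
  ext_homog : homog_mx (@st_shift ext_stage) (@st_shift X) ext_mx;
  ext_gen : forall u, st_rel u <-> exists v, u = v *m ext_mx;
  ext_rel : forall v, v *m ext_mx = 0 <-> st_rel v
}.

Lemma extension_inhabited (X : stage) : inhabited (extension X).
Proof.
have [r [s [D [[hD genD] minD]]]] := minimal_generators (@st_sub X) (@st_graded X).
have subD : submodule (fun v : 'rV[R]_r => v *m D = 0).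
  split=> [|c u v uD vD]; first exact: mul0mx.
  by rewrite mulmxDl -scalemxAl uD vD scaler0 addr0.
by exists; exists (Stage subD (graded_ker hD) minD) D.
Qed.

(** A step is only known to exist, so it is chosen by [epsilon] to permit the recursion in
    [stages]. *)
Definition extend (X : stage) : extension X :=
  epsilon (extension_inhabited X) (fun _ => True).

Fixpoint stages (X : stage) (i : nat) : stage :=
  if i is i'.+1 then ext_stage (extend (stages X i')) else X.

Definition resolution_of (X : stage) : free_sequence K N :=
  @FreeSequence K N (fun i => st_rank (stages X i))
    (fun i => @st_shift (stages X i)) (fun i => ext_mx (extend (stages X i)))
    (fun i => ext_homog (e := extend (stages X i))).

Lemma minimal_resolution_ex (V : lmodType R) (gr : int -> V -> Prop)
    (r : nat) (s : 'I_r -> int) (e : 'I_r -> V) :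
  let aug (u : 'rV[R]_r) := \sum_(j < r) u 0 j *: e j in
  (forall j, gr (s j) (e j)) -> (forall x, exists u, aug u = x) ->
  graded s (fun u => aug u = 0) ->
  (forall u, aug u = 0 -> forall j, irrelevant (u 0 j)) ->
  exists (F : free_sequence K N) (e : 'I_(rank F 0) -> V),
    is_minimal_graded_free_resolution gr e.
Proof.
move=> aug gr_e aug_surj gr_ker irr_ker.
have sub_ker : submodule (fun u => aug u = 0).
  split=> [|c u v uK vK]; first by apply: big1 => j _; rewrite mxE scale0r.
  transitivity (c *: aug u + aug v); last by rewrite uK vK scaler0 addr0.
  rewrite scaler_sumr -big_split; apply: eq_bigr => j _.
  by rewrite !mxE scalerDl scalerA.
pose X := Stage sub_ker gr_ker irr_ker.
exists (resolution_of X), e; split=> //= [u|i u|i j l].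
- exact: (@ext_gen X (extend X) u).
- rewrite (@ext_rel _ (extend (stages X i)) u).
  exact: (@ext_gen _ (extend (ext_stage (extend (stages X i)))) u).
(* Minimality: the rows of the differential are relations of the previous stage, whose entries have
   no constant term. *)
have : st_rel (row j (ext_mx (extend (stages X i)))).
  by apply/ext_gen; eexists; apply: rowE.
by move=> /st_irrelevant/(_ l); rewrite mxE.
Qed.

End MinimalResolutions.

(** * Algebraic dependence of n + 1 polynomials in n variables *)

Section AlgebraicDependence.
Context (K : fieldType) (n : nat).
Local Notation S := {mpoly K[n]}.

Let deg_le d (p : S) := forall m, m \in msupp p -> (mdeg m <= d)%N.

Let deg_leM d e p q : deg_le d p -> deg_le e q -> deg_le (d + e)%N (p * q).
Proof.
move=> dp dq m /msuppM_le/allpairsP[[m1 m2] /= [m1p m2q ->]].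
by rewrite mdegD leq_add ?dp ?dq.
Qed.

Lemma rectangular_kernel (a b : nat) (M : 'M[K]_(a, b)) :
  (b < a)%N -> exists2 v : 'rV_a, v != 0 & v *m M = 0.
Proof.
move=> lt_ba; have : kermx M != 0.
  rewrite kermx_eq0 /row_free neq_ltn.
  by rewrite (leq_ltn_trans (rank_leq_col M) lt_ba).
by move=> /rowV0Pn[v /sub_kermxP vM v0]; exists v.
Qed.

(** By counting: the t^(n+1) products with exponents below t lie in the span of the B^n monomials
    with exponents below B, and B^n = C^n t^n < t^(n+1). *)
Lemma algebraic_dependence (g : 'I_n.+1 -> S) :
  exists t (c : {ffun 'I_n.+1 -> 'I_t} -> K),
    (exists m, c m != 0) /\ \sum_m c m *: \prod_i g i ^+ m i = 0.
Proof.
(* Since d bounds the degrees of the g_i, the products have degree at most (n + 1) t d < C t = B. *)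
pose d := (\max_i msize (g i))%N; pose C := (n.+1 * d).+1; pose t := (C ^ n).+1.
pose B := (C * t)%N.
pose T := {ffun 'I_n.+1 -> 'I_t}; pose box := {ffun 'I_n -> 'I_B}.
have dprod (m : T) : deg_le (n.+1 * (t * d))%N (\prod_i g i ^+ m i).
  rewrite -{1}[n.+1]card_ord -sum_nat_const.
  have d1 : deg_le 0 1 by move=> m'; rewrite msupp1 inE => /eqP->; rewrite mdeg0.
  elim/big_ind2: _ => // [p dp q dq|i _]; first exact: deg_leM.
  have dX e : deg_le (e * d)%N (g i ^+ e).
    elim: e => [//|e IH]; rewrite exprS mulSn; apply: deg_leM => // m' m'g.
    apply: ltnW; apply: leq_trans (msize_mdeg_lt m'g) _.
    exact: (leq_bigmax (F := fun i => msize (g i))).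
  by move=> m' /dX le_m'; apply: leq_trans le_m' _; rewrite leq_mul2r ltnW ?orbT.
pose mon (b : box) : 'X_{1..n} := [multinom (b i : nat) | i < n].
pose M := \matrix_(a < #|{: T}|, b < #|{: box}|)
  (\prod_i g i ^+ (enum_val a : T) i)@_(mon (enum_val b)).
have [|v v0 vM] := rectangular_kernel M.
  rewrite !card_ffun !card_ord /B expnMn expnS ltn_pmul2r //.
  by rewrite expn_gt0.
exists t, (fun m => v 0 (enum_rank m)); split.
  have [a va] : exists a, v 0 a != 0 by apply/rV0Pn.
  by exists (enum_val a); rewrite enum_valK.
apply/mpolyP => m; rewrite raddf_sum mcoeff0 /=.
have [/forallP m_box|/forallPn[i ltBm]] := boolP [forall i, (m i < B)%N].
  pose b : box := [ffun i => Ordinal (m_box i)].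
  have -> : m = mon b by apply/mnmP => i; rewrite mnmE ffunE.
  have := congr1 (fun w : 'rV_#|{: box}| => w 0 (enum_rank b)) vM.
  rewrite !mxE => E; rewrite -[RHS]E (reindex (@enum_val _ (mem T))) /=; last first.
    by apply/onW_bij/enum_val_bij.
  by apply: eq_bigr => a _; rewrite mcoeffZ enum_valK mxE enum_rankK.
apply: big1 => m' _; rewrite mcoeffZ memN_msupp_eq0 ?mulr0 //.
apply: contra ltBm => /dprod le_m.
have lt_mB : (mdeg m < B)%N.
  apply: leq_ltn_trans le_m _.
  rewrite mulnA mulnAC /B /C; move: (n.+1 * d)%N => x.
  by rewrite mulSn -[ltnLHS]add0n ltn_add2r.
by apply: leq_ltn_trans lt_mB; rewrite mdegE (bigD1 i) //= leq_addr.
Qed.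

End AlgebraicDependence.

(** * Chains of ideals separated by nonzerodivisors *)

Section RegularChains.
Context (K : fieldType) (n : nat) (R : comAlgType K).
Context (phi : {rmorphism R -> {mpoly K[n]}}).
Context (J : nat -> R -> Prop) (f : 'I_n.+1 -> R).
Hypothesis phiZ : forall c x, phi (c *: x) = c *: phi x.
Hypothesis J_ker : forall x, phi x = 0 -> J 0 x.
Hypothesis JD : forall i x y, J i x -> J i y -> J i (x + y).
Hypothesis JM : forall i a x, J i x -> J i (a * x).
Hypothesis J_mono : forall (i : 'I_n.+1) x, J i x -> J i.+1 x.
Hypothesis Jf : forall i : 'I_n.+1, J i.+1 (f i).
Hypothesis J_reg : forall (i : 'I_n.+1) x, J i (f i * x) -> J i x.

(* A polynomial relation between the images of the f_i is peeled off one
   variable at a time: only its terms of lexicographically minimal exponent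
   survive, so that in the end a nonzero constant lies in the last ideal. *)
Lemma regular_chain_improper : J n.+1 1.
Proof.
have [t [c [[m0 cm0] c_rel]]] := algebraic_dependence (phi \o f).
pose Q i (m : {ffun 'I_n.+1 -> 'I_t}) := \prod_(l < n.+1 | (i <= l)%N) f l ^+ m l.
have JZ i a x : J i x -> J i (a *: x).
  by move/(JM (a *: 1)); rewrite -scalerAl mul1r.
have J0 i : (i <= n.+1)%N -> J i 0.
  elim: i => [|i IH] lt_i; first by apply: J_ker; rewrite rmorph0.
  exact/(J_mono (i := Ordinal lt_i))/IH/ltnW.
(* After i steps the surviving exponents agree in their first i entries, and the powers of f_0, ...,
   f_(i-1) are cancelled. *)
suff peel i : (i <= n.+1)%N -> exists s : {set {ffun 'I_n.+1 -> 'I_t}}, [/\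
    exists m, m \in s, forall m, m \in s -> c m != 0,
    forall m m' (l : 'I_n.+1), m \in s -> m' \in s -> (l < i)%N -> m l = m' l
    & J i (\sum_(m in s) c m *: Q i m)].
  have [s [[m ms] s_nz s_eq]] := peel n.+1 (leqnn _).
  have -> : s = [set m].
    apply/setP => m'; rewrite inE; apply/idP/eqP => [m's|->//].
    by apply/ffunP => l; apply: s_eq.
  rewrite big_set1 /Q big_pred0 => [/(JZ _ (c m)^-1)|l]; last by rewrite leqNgt ltn_ord.
  by rewrite scalerA mulVf ?scale1r // s_nz.
elim: i => [_|i IH lt_i].
  exists [set m | c m != 0]; split=> [|m|//|]; first by exists m0; rewrite inE.
    by rewrite inE.
  apply: J_ker; rewrite -[RHS]c_rel raddf_sum big_mkcond /=.
  apply: eq_bigr => m _; rewrite inE; case: eqP => [->|_]; first by rewrite !scale0r.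
  rewrite phiZ rmorph_prod; congr (_ *: _).
  by apply: eq_bigr => l _; rewrite rmorphXn.
have [s [[m1 m1s] s_nz s_eq Js]] := IH (ltnW lt_i).
pose o := Ordinal lt_i; pose k : nat := [arg min_(m < m1 in s) (m o : nat)] o.
have [k_ex k_min] : (exists2 m, m \in s & m o = k :> nat) /\
    forall m, m \in s -> (k <= m o)%N.
  by rewrite /k; case: arg_minnP => // m ms min_m; split=> //; exists m.
have QS m : Q i m = f o ^+ m o * Q i.+1 m.
  rewrite /Q (bigD1 o) //=; congr (_ * _); apply: eq_bigl => l.
  by rewrite ltn_neqAle -(inj_eq val_inj) /= eq_sym andbC.
(* The factor f_i^k common to all terms is cancelled by [J_reg]. *)
pose Y := \sum_(m in s) c m *: (f o ^+ (m o - k) * Q i.+1 m).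
have JY : J i.+1 Y.
  apply: (J_mono (i := o)).
  have regk e x : J o (f o ^+ e * x) -> J o x.
    elim: e x => [|e IHe] x; first by rewrite mul1r.
    by rewrite exprS -mulrA => /J_reg/IHe.
  apply: (regk k); rewrite mulr_sumr; move: Js; congr (J _ _).
  apply: eq_bigr => m ms; rewrite -scalerAr mulrA -exprD subnKC ?k_min //.
  by rewrite QS.
pose s' := [set m in s | (m o : nat) == k].
exists s'; split.
- by have [m ms mk] := k_ex; exists m; rewrite inE ms mk eqxx.
- by move=> m; rewrite inE => /andP[/s_nz].
- move=> m m' l; rewrite !inE => /andP[ms /eqP mk] /andP[m's /eqP m'k].
  rewrite ltnS leq_eqVlt => /orP[/eqP li|]; last exact: s_eq.
  have -> : l = o by apply: val_inj.
  by apply: val_inj; rewrite /= mk m'k.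
pose Y' := \sum_(m in s | (m o : nat) != k) c m *: (f o ^+ (m o - k) * Q i.+1 m).
have JY' : J i.+1 Y'.
  apply: big_ind => [||m /andP[ms ne]]; [exact: J0|exact: JD|apply: JZ].
  have lt_km : (k < m o)%N by rewrite ltn_neqAle eq_sym ne k_min.
  have lt0 : (0 < m o - k)%N by rewrite subn_gt0.
  rewrite -(prednK lt0) exprSr -mulrA [f o * _]mulrC mulrA.
  by apply: JM; apply: (Jf o).
have -> : \sum_(m in s') c m *: Q i.+1 m = Y + (-1) * Y'.
  rewrite mulN1r /Y'.
  rewrite [Y in _ = Y - _](bigID (fun m : {ffun _ -> 'I_t} => (m o : nat) == k)) /=.
  rewrite addrK.
  apply: eq_big => m; first by rewrite inE.
  by rewrite inE => /andP[_ /eqP->]; rewrite subnn mul1r.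
exact/JD/JM.
Qed.

End RegularChains.

(** * A socle criterion for maximal projective dimension *)

Section ProjectiveDimension.
Context (K : fieldType) (N : nat) (V : lmodType {mpoly K[N]}).
Local Notation R := {mpoly K[N]}.

Lemma resolution_complex (gr : int -> V -> Prop) (F : free_sequence K N)
    (e : 'I_(rank F 0) -> V) :
  is_minimal_graded_free_resolution gr e -> forall i, diff F i.+1 *m diff F i = 0.
Proof.
case=> _ _ _ exF _ i; apply/row_matrixP => j; rewrite row0 row_mul.
by apply/exF; eexists; apply: rowE.
Qed.

(* The last two hypotheses say that z is a nonzero socle element of
   V / X_j V. *)
Lemma maximal_pdim (gr : int -> V -> Prop) (F : free_sequence K N)
    (e : 'I_(rank F 0) -> V) (j : 'I_N) (z : V) :
  j = 0%N :> nat -> is_minimal_graded_free_resolution gr e ->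
  (forall x : V, 'X_j *: x = 0 -> x = 0) -> (forall x : V, z <> 'X_j *: x) ->
  (forall l, exists x : V, 'X_l *: z = 'X_j *: x) ->
  has_length F N.-1.
Proof.
move=> j0 resF V_reg z_nz z_soc; have DD := resolution_complex resF.
case: resF => _ aug_surj ex_aug exF minF.
have augD u v : augmentation e (u + v) = augmentation e u + augmentation e v.
  by rewrite -big_split; apply: eq_bigr => i _; rewrite mxE scalerDl.
have augZ c u : augmentation e (c *: u) = c *: augmentation e u.
  by rewrite scaler_sumr; apply: eq_bigr => i _; rewrite mxE scalerA.
have augB u v : augmentation e (u - v) = augmentation e u - augmentation e v.
  by rewrite augD -[- v]scaleN1r augZ scaleN1r.
have augd v : augmentation e (v *m diff F 0) = 0 by apply/ex_aug; exists v.
pose kl i : {rmorphism R -> R} := @kill K N i.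
have kl0 f : kl 0 f = 0 -> f = 0 by rewrite /= kill0.
have klS := @killS_eq0 K N : forall i f, kl i f = 0 -> kl i.+1 f = 0.
have klSy := @killS_X K N : forall i : 'I_N, kl i.+1 'X_i = 0.
have kl_reg := @kill_reg K N : forall (i : 'I_N) f, kl i ('X_i * f) = 0 -> kl i f = 0.
have klSE := @killS_eq0E K N : forall (i : 'I_N) f,
  kl i.+1 f = 0 -> exists g, kl i (f - 'X_i * g) = 0.
have killed1E m (u : 'rV[R]_m) : killed kl 1 u -> exists w, u = 'X_j *: w.
  rewrite -[1%N]/(0.+1) -{1}j0 => /(killedSE klSE)[w]; rewrite j0 => /(killed0P kl0) E.
  by exists w; apply/eqP; rewrite -subr_eq0 E.
have killed1X m (u : 'rV[R]_m) : killed kl 1 ('X_j *: u).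
  by rewrite -[1%N]/(0.+1) -{1}j0; apply: (killed_y klSy).
have ex0 i : exact_mod kl (diff F) 0 i.
  move=> u /(killed0P kl0)/exF[v ->]; exists v.
  by apply/killedP => a b; rewrite subrr mxE rmorph0.
(* As X_j acts injectively on V, u D_0 = X_j w forces w = v D_0 for some v, and u - X_j v is a
   cycle. *)
have ex1 : exact_mod kl (diff F) 1 0.
  move=> u /killed1E[w uw].
  have [v wv] : exists v, w = v *m diff F 0.
    by apply/ex_aug/V_reg; rewrite -augZ -uw augd.
  have [|t tE] := (exF 0%N (u - 'X_j *: v)).1.
    by rewrite mulmxBl -scalemxAl -wv uw subrr.
  by exists t; rewrite -tE opprB addrC subrK.
(* V is the cokernel of D_0, so a preimage of z under the augmentation represents the socle
   element. *)
have soc : socle_mod (fun i : 'I_N => 'X_i) kl (diff F) 1 0.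
  have [z' z'z] := aug_surj z; exists z'; split=> [v /killed1E[w /eqP]|l _].
    rewrite subr_eq => /eqP E; apply: (z_nz (augmentation e w)).
    by rewrite -z'z E augD augd addr0 augZ.
  have [x zx] := z_soc l; have [x' x'x] := aug_surj x.
  have [|v vE] := (ex_aug ('X_l *: z' - 'X_j *: x')).1.
    by rewrite augB !augZ z'z x'x zx subrr.
  by exists v; rewrite -vE opprB addrC subrK.
have N_gt0 : (0 < N)%N by apply: leq_trans (ltn_ord j).
split; first exact: (rank_gt0 klS klSy kl_reg klSE DD ex0 ex1 N_gt0 soc).
move=> i; rewrite prednK // => le_Ni.
apply: (rank_eq0 klS klSy kl_reg klSE DD ex0 ex1 N_gt0 _ le_Ni).
move=> i'; apply/killedP => a b; apply/kill_all_eq0; exact: minF.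
Qed.

End ProjectiveDimension.

(** * The submodule I V for a finitely generated ideal I *)

Section IdealTimesModule.
Context (R : comNzRingType) (V : lmodType R).
Implicit Types (s t : seq R) (x y : V).

Lemma in_ideal_mul_nil x : in_ideal_mul [::] x <-> x = 0.
Proof.
split=> [[y ->]|->]; first by rewrite big_ord0.
by exists (fun _ => 0); rewrite big_ord0.
Qed.

Lemma in_ideal_mul_cons f s x :
  in_ideal_mul (f :: s) x <-> exists y, in_ideal_mul s (x - f *: y).
Proof.
split=> [[y ->]|[y [z E]]].
  exists (y ord0), (fun i => y (lift ord0 i)).
  by rewrite big_ord_recl /= addrC addKr.
exists (fun i => if unlift ord0 i is Some i' then z i' else y).
rewrite big_ord_recl unlift_none /= -[x](subrK (f *: y)) E addrC.
by congr (_ + _); apply: eq_bigr => i _; rewrite liftK.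
Qed.

Lemma in_ideal_mul_submodule s : submodule (in_ideal_mul (V := V) s).
Proof.
split=> [|c x y [x' ->] [y' ->]].
  by exists (fun _ => 0); rewrite big1 // => i _; rewrite scaler0.
exists (fun i => c *: x' i + y' i); rewrite scaler_sumr -big_split.
by apply: eq_bigr => i _; rewrite scalerDr !scalerA mulrC.
Qed.

Lemma in_ideal_mul_min s (Z : V -> Prop) x : submodule Z ->
  (forall f y, f \in s -> Z (f *: y)) -> in_ideal_mul s x -> Z x.
Proof.
move=> subZ sZ [y ->]; apply: submodule_sum => // i.
by apply: sZ; apply: mem_nth.
Qed.

Lemma in_ideal_mul_mem s f x : f \in s -> in_ideal_mul s (f *: x).
Proof.
move=> fs; have lt_f : (index f s < size s)%N by rewrite index_mem.
exists (fun i => if i == Ordinal lt_f then x else 0).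
rewrite (bigD1 (Ordinal lt_f)) //= eqxx nth_index // big1 ?addr0 // => i /negPf->.
by rewrite scaler0.
Qed.

Lemma in_ideal_mul_sub s t x :
  {subset s <= t} -> in_ideal_mul s x -> in_ideal_mul t x.
Proof.
move=> st; apply: in_ideal_mul_min (in_ideal_mul_submodule t) _ => f y /st.
exact: in_ideal_mul_mem.
Qed.

End IdealTimesModule.

(** * Prime ideals as kernels of maps to domains *)

Section KernelIdeals.
Context (A : comNzRingType) (B : idomainType) (g : {rmorphism A -> B}).

Definition ker_pred : {pred A} := fun f => g f == 0.

Fact ker_zmod_closed : zmod_closed ker_pred.
Proof.
split=> [|u v]; rewrite !unfold_in /ker_pred; first by rewrite rmorph0.
by move=> /eqP gu /eqP gv; rewrite rmorphB gu gv subrr.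
Qed.
HB.instance Definition _ := GRing.isZmodClosed.Build A ker_pred ker_zmod_closed.

Fact ker_proper :
  1 \notin ker_pred /\ forall u, {in ker_pred, forall v, u * v \in ker_pred}.
Proof.
split=> [|u v]; rewrite !unfold_in /ker_pred; first by rewrite rmorph1 oner_eq0.
by move=> /eqP gv; rewrite rmorphM gv mulr0.
Qed.
HB.instance Definition _ := isProperIdeal.Build A ker_pred ker_proper.

Fact ker_prime : prime_idealr_closed ker_pred.
Proof. by move=> u v; rewrite !unfold_in /ker_pred rmorphM mulf_eq0. Qed.
HB.instance Definition _ := isPrimeIdealrClosed.Build A ker_pred ker_prime.

Definition ker_prime_ideal : prime_idealr A := ker_pred.

Lemma mem_ker_prime_ideal f : (f \in ker_prime_ideal) = (g f == 0).
Proof. by []. Qed.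

End KernelIdeals.

(** * The Veronese map on monomials and degrees *)

Section VeroneseMap.
Context (K : fieldType) (n d : nat) (a : degree_enum n d).
Local Notation S := {mpoly K[n]}.
Local Notation R := {mpoly K[nvars n d]}.
Local Notation phi := (@veronese_map K n d a).

HB.instance Definition _ := GRing.RMorphism.copy (@veronese_map K n d a)
  (comp_mpoly [tuple 'X_[a i] : S | i < nvars n d]).

Lemma veronese_mapX i : phi 'X_i = 'X_[a i].
Proof. by rewrite /veronese_map comp_mpolyXU -tnth_nth tnth_mktuple. Qed.

Lemma veronese_mapC c : phi c%:MP = c%:MP.
Proof. exact: comp_mpolyC. Qed.

Lemma veronese_mapZ c f : phi (c *: f) = c *: phi f.
Proof. by rewrite -!mul_mpolyC rmorphM /= veronese_mapC. Qed.

Lemma veronese_mapXm m :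
  exists2 m' : 'X_{1..n}, mdeg m' = (mdeg m * d)%N & phi 'X_[m] = 'X_[m'].
Proof.
exists (\sum_i (a i *+ m i))%MM.
  rewrite mdeg_sum mdegE big_distrl /=; apply: eq_bigr => i _.
  by rewrite mdegMn mdeg_expo mulnC.
rewrite (big_morph _ (@mpolyXD n K) (mpolyX0 n K)) mpolyXE_id rmorph_prod.
by apply: eq_bigr => i _; rewrite rmorphXn /= veronese_mapX mpolyXn.
Qed.

Lemma mon_split e (m : 'X_{1..n}) : (e <= mdeg m)%N ->
  exists m1 m2, m = (m1 + m2)%MM /\ mdeg m1 = e.
Proof.
elim: e => [|e IH] lt_e; first by exists 0%MM, m; rewrite add0m mdeg0.
have [m1 [m2 [Em m1e]]] := IH (ltnW lt_e).
have : m2 != 0%MM.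
  by apply: contraTneq lt_e => E; rewrite Em E addm0 m1e ltnn.
rewrite -mdeg_eq0 mdegE sum_nat_eq0 => /forallPn[i m2i].
exists (m1 + U_(i))%MM, (m2 - U_(i))%MM; split; last by rewrite mdegD mdeg1 m1e addn1.
rewrite Em -addmA; congr (_ + _)%MM; rewrite addmC submK //.
by apply/mnm_lepP => l; rewrite mnm1E; case: eqP => // <-; rewrite lt0n.
Qed.

Lemma veronese_map_monomial i m :
  mdeg m = (i * d)%N -> exists f, phi f = 'X_[m].
Proof.
elim: i m => [|i IH] m Em.
  move/eqP: Em; rewrite mdeg_eq0 => /eqP->.
  by exists 1; rewrite rmorph1 mpolyX0.
have [|m1 [m2 [E m1d]]] := @mon_split d m; first by rewrite Em mulSn leq_addr.
have [l al] := expo_surj a m1d.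
have [|f fE] := IH m2.
  by apply/eqP; rewrite -(eqn_add2l d) -{1}m1d -mdegD -E Em mulSn.
by exists ('X_l * f); rewrite rmorphM /= veronese_mapX fE al E mpolyXD.
Qed.

Lemma hcomp_veronese_map (hd : (0 < d)%N) e f :
  hcomp (e * d%:Z) (phi f) = phi (hcomp e f).
Proof.
rewrite [f]mpolyE [hcomp e _]raddf_sum !(raddf_sum (veronese_map a)) [LHS]raddf_sum.
apply: eq_bigr => m _ /=.
rewrite linearZ /= !veronese_mapZ linearZ /= hcompX; congr (_ *: _).
have [m' m'd Em] := veronese_mapXm m; rewrite Em hcompX m'd PoszM.
rewrite (inj_eq (mulIf _)) ?eqz_nat -?lt0n //.
by case: ifP => _; rewrite ?Em ?rmorph0.
Qed.

End VeroneseMap.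

(** * Krull dimension, and the bound n for regular sequences *)

Section VeroneseModules.
Context (K : fieldType) (n d k : nat) (a : degree_enum n d).
Hypotheses (n_gt0 : (0 < n)%N) (d_gt0 : (0 < d)%N).
Local Notation S := {mpoly K[n]}.
Local Notation R := {mpoly K[nvars n d]}.
Local Notation V := (veronese_module K k a).
Local Notation phi := (@veronese_map K n d a).

Lemma veronese_valZ f (x : V) : veronese_val (f *: x) = phi f * veronese_val x.
Proof. by []. Qed.

Lemma veronese_valB (x y : V) :
  veronese_val (x - y) = veronese_val x - veronese_val y.
Proof. by []. Qed.

Lemma veronese_val0 : veronese_val (0 : V) = 0.
Proof. by []. Qed.

Lemma veronese_val_sum (I : Type) (r : seq I) (F : I -> V) :
  veronese_val (\sum_(i <- r) F i) = \sum_(i <- r) veronese_val (F i).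
Proof. exact: (big_morph (fun x : V => veronese_val x)). Qed.

Lemma veronese_val_inj (x y : V) : veronese_val x = veronese_val y -> x = y.
Proof. exact: val_inj. Qed.

Lemma veronese_val_deg (x : V) m : m \in msupp (veronese_val x) ->
  exists i, mdeg m = (k + i * d)%N.
Proof. by case: x => p /= /veronese_predP Hp mp; apply: Hp; rewrite -mcoeff_msupp. Qed.

Lemma veronese_pred_monomial c m i :
  mdeg m = (k + i * d)%N -> c *: 'X_[m] \in veronese_pred (K := K) (n := n) d k.
Proof.
move=> Em; apply/veronese_predP => m'; rewrite mcoeffZ mcoeffX.
by have [<- _|_] := eqVneq m m'; [exists i | rewrite mulr0 eqxx].
Qed.

Lemma veronese_monomial m i : mdeg m = (k + i * d)%N ->
  exists x : V, veronese_val x = 'X_[m].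
Proof.
move=> Em; have := veronese_pred_monomial 1 Em.
by rewrite scale1r => Hm; exists (Veronese Hm).
Qed.

Let x0 : 'I_n := Ordinal n_gt0.

Lemma veronese_exists_pow : exists x : V, veronese_val x = 'X_[U_(x0) *+ k].
Proof. by apply: (@veronese_monomial _ 0); rewrite mdegMn mdeg1 mul1n addn0. Qed.

Lemma mpolyX_neq0 m : 'X_[m] != 0 :> S.
Proof. by rewrite -msize_poly_eq0 msizeX. Qed.

(** V contains the nonzero element x_1^k of the domain S. *)
Lemma veronese_annihilator f : in_annihilator V f <-> phi f = 0.
Proof.
split=> [fV|f0 x]; last by apply: veronese_val_inj; rewrite veronese_valZ f0 mul0r.
have [x Ex] := veronese_exists_pow.
have /(congr1 (@veronese_val _ _ _ _))/eqP := fV x.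
by rewrite veronese_valZ Ex mulf_eq0 (negPf (mpolyX_neq0 _)) orbF => /eqP.
Qed.

Lemma pure_power_ex (j : 'I_n) : exists i, a i = (U_(j) *+ d)%MM.
Proof. by apply: expo_surj; rewrite mdegMn mdeg1 mul1n. Qed.

Lemma kill_mnm (j : nat) (m : 'X_{1..n}) :
  kill j ('X_[m] : S) = if [exists i : 'I_n, (i < j)%N && (0 < m i)%N] then 0 else 'X_[m].
Proof.
rewrite mpolyXE_id rmorph_prod /=; case: existsP => [[i /andP[lt_ij mi]]|no].
  by rewrite (bigD1 i) //= rmorphXn /= killX lt_ij expr0n eqn0Ngt mi mul0r.
apply: eq_bigr => i _; rewrite rmorphXn /= killX; case: ifP => // lt_ij.
have -> : m i = 0%N.
  by apply/eqP; rewrite -leqn0 leqNgt; apply/negP => mi; apply: no; exists i; rewrite lt_ij.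
by rewrite !expr0.
Qed.

(** The variable of R mapping to x_(i+1)^d separates the i-th prime from all later ones. *)
Lemma veronese_support_chain : is_support_chain V
  (fun i : 'I_n.+1 => ker_prime_ideal (@kill K n i \o phi)).
Proof.
split=> [i f /veronese_annihilator f0|i j lt_ij].
  by rewrite mem_ker_prime_ideal /= f0 rmorph0.
split=> [f|].
  rewrite !mem_ker_prime_ideal /= => /eqP f0.
  by rewrite -(maxn_idPl (ltnW lt_ij)) -kill_kill f0 rmorph0.
have lt_in : (i < n)%N by apply: leq_trans lt_ij _; rewrite -ltnS.
have [l al] := pure_power_ex (Ordinal lt_in).
exists 'X_l; rewrite mem_ker_prime_ideal /= veronese_mapX al kill_mnm.
  rewrite (_ : [exists _, _]); first by [].
  apply/existsP; exists (Ordinal lt_in); rewrite lt_ij mulmnE mnm1E eqxx mul1n.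
  exact: d_gt0.
case: existsP => [[i' /andP[lt_i']]|_]; last exact: mpolyX_neq0.
rewrite mulmnE mnm1E; case: eqP => [E|_]; last by rewrite mul0n.
by move: lt_i'; rewrite -E /= ltnn.
Qed.

Lemma veronese_krull_dim : has_krull_dim V n.
Proof.
split=> [|s P [annP chainP]]; first by eexists; exact: veronese_support_chain.
rewrite leqNgt; apply/negP => lt_ns.
(* [inord] selects P_0, ..., P_(n+1) from the long chain. An element of P_(i+1) outside the prime
   P_i is a nonzerodivisor modulo P_i. *)
have stepP (i : 'I_n.+1) : {subset P (inord i) <= P (inord i.+1)} /\
    exists2 f, f \in P (inord i.+1) & f \notin P (inord i).
  have lt_is : (i < s)%N by apply: leq_trans lt_ns; rewrite ltnS -ltnS.
  by apply: chainP; rewrite !inordK // ltnS // ltnW.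
have [f fP fnP] := fin_all_exists2 (fun i => (stepP i).2).
have : (1 : R) \in P (inord n.+1); last by rewrite idealr1.
apply: (@regular_chain_improper K n R phi (fun i x => x \in P (inord i)) f) => //.
- exact: veronese_mapZ.
- by move=> x x_ker; apply: annP; apply/veronese_annihilator.
- by move=> i x y; apply: rpredD.
- by move=> i u x; apply: idealMr.
- by move=> i x; apply: (stepP i).1.
- by move=> i x; rewrite prime_idealrM (negPf (fnP i)).
Qed.

Lemma veronese_regular_leq (s : seq R) : is_regular_seq V s -> (size s <= n)%N.
Proof.
move=> [regs [x nx]]; rewrite leqNgt; apply/negP => lt_ns; apply: nx.
have take_sub i : {subset take i s <= take i.+1 s}.
  by move=> f; rewrite -[take i s](take_takel s (leqnSn i)) => /mem_take.
(* J_i is the colon ideal of all g with g V inside (s_0, ..., s_(i-1)) V. Regularity on V makes s_i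
   a nonzerodivisor modulo J_i, and 1 in J_(n+1) would contradict V <> s V. *)
pose J i g := forall y : V, in_ideal_mul (take i s) (g *: y).
suff /(_ x) : J n.+1 1.
  by rewrite scale1r; apply: in_ideal_mul_sub => f /mem_take.
apply: (@regular_chain_improper K n R phi J (fun i => s`_i)).
- exact: veronese_mapZ.
- move=> g /veronese_annihilator gV y; rewrite take0 gV.
  exact/in_ideal_mul_nil.
- move=> i g h Jg Jh y; rewrite scalerDl.
  exact: (submoduleD (in_ideal_mul_submodule _ _)).
- move=> i u g Jg y; rewrite -scalerA.
  exact: (submoduleZ _ (in_ideal_mul_submodule _ _)).
- by move=> i g Jg y; apply: in_ideal_mul_sub (Jg y).
- move=> i y; apply: in_ideal_mul_mem.
  have lt_is : (i < size s)%N by apply: leq_trans lt_ns; rewrite ltn_ord.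
  by rewrite (take_nth 0 lt_is) mem_rcons mem_head.
move=> i g Jg y; apply: regs; last by rewrite scalerA.
by apply: leq_trans lt_ns; rewrite ltn_ord.
Qed.

End VeroneseModules.

(** * Depth for k < d, and regular sequences for d <= k *)

Section VeroneseDepth.
Context (K : fieldType) (n d k : nat) (a : degree_enum n d).
Hypotheses (n_gt0 : (0 < n)%N) (d_gt0 : (0 < d)%N).
Local Notation S := {mpoly K[n]}.
Local Notation R := {mpoly K[nvars n d]}.
Local Notation V := (veronese_module K k a).
Local Notation phi := (@veronese_map K n d a).

Section SmallShift.
Hypothesis lt_kd : (k < d)%N.
Context (y : 'I_n -> 'I_(nvars n d)).
Hypothesis ay : forall j, a (y j) = (U_(j) *+ d)%MM.

Lemma pure_power_le (j : 'I_n) (m : 'X_{1..n}) :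
  (U_(j) *+ d <= m)%MM = (d <= m j)%N.
Proof.
apply/mnm_lepP/idP => [/(_ j)|le_dm i]; rewrite mulmnE mnm1E ?eqxx ?mul1n //.
by case: eqP => [<-|_]; rewrite ?mul1n // mul0n.
Qed.

(** Membership can be tested on monomials because, for k < d, a monomial of V divisible by x_j^d has
    its quotient in V again. *)
Lemma in_pure_powers_mul (l : seq 'I_n) (x : V) :
  in_ideal_mul [seq 'X_(y j) | j <- l] x <->
  forall m, m \in msupp (veronese_val x) -> exists2 j, j \in l & (d <= m j)%N.
Proof.
split; elim: l x => [|j l IH] x /=.
- by move=> /in_ideal_mul_nil -> m; rewrite veronese_val0 msupp0.
- move=> /in_ideal_mul_cons[z /IH xz] m.
  rewrite -[veronese_val x](subrK ('X_[U_(j) *+ d] * veronese_val z)).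
  move=> /msuppD_le; rewrite mem_cat => /orP[mxz|].
    have [|j' j'l le_d] := xz m; first by rewrite veronese_valB veronese_valZ veronese_mapX ay.
    by exists j'; rewrite ?inE ?j'l ?orbT.
  rewrite mulrC (perm_mem (msuppMX _ _)) => /mapP[m' _ ->].
  by exists j; rewrite ?mem_head // -pure_power_le lem_addr.
- move=> x0; apply/in_ideal_mul_nil/veronese_val_inj/msuppnil0.
  by case E: (msupp _) => [//|m s]; have [|] := x0 m; rewrite ?E ?mem_head.
move=> xl; apply/in_ideal_mul_cons.
pose p := veronese_val x; pose P (m : 'X_{1..n}) := (d <= m j)%N.
pose q : S := \sum_(m <- msupp p | P m) p@_m *: 'X_[m - U_(j) *+ d].
have qV : q \in veronese_pred d k.
  rewrite /q big_seq_cond; apply: rpred_sum => m /andP[mx Pm].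
  (* As the degree of m is at least d > k, the coefficient of d in it is positive and can be lowered
     by one. *)
  have [[|i] Em] := veronese_val_deg mx; have le_dm : (d <= mdeg m)%N.
  - by apply: leq_trans Pm _; rewrite mdegE (bigD1 j) //= leq_addr.
  - by move: le_dm; rewrite Em mul0n addn0 leqNgt lt_kd.
  - by apply: leq_trans Pm _; rewrite mdegE (bigD1 j) //= leq_addr.
  apply: (@veronese_pred_monomial _ _ _ _ _ _ i).
  have le_m : (U_(j) *+ d <= m)%MM by rewrite pure_power_le.
  apply/eqP; rewrite -(eqn_add2r (mdeg (U_(j) *+ d)%MM)) -mdegD submK // Em.
  by rewrite mdegMn mdeg1 mul1n mulSn addnAC addnA.
exists (Veronese qV : V); apply: IH => m.
rewrite veronese_valB veronese_valZ veronese_mapX ay /= mulr_sumr.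
have pP : \sum_(m <- msupp p | P m) p@_m *: 'X_[m] =
    \sum_(m <- msupp p | P m) 'X_[U_(j) *+ d] * (p@_m *: 'X_[m - U_(j) *+ d]).
  apply: eq_bigr => m' Pm'; rewrite -scalerAr -mpolyXD addmC submK //.
  by rewrite pure_power_le.
rewrite -/p {1}[p]mpolyE (bigID P) /= addrC pP addrK -big_filter.
rewrite (perm_mem (msupp_sumX _ _)) ?filter_uniq ?msupp_uniq //.
  rewrite mem_filter => /andP[nPm /xl[j']]; rewrite inE => /predU1P[->|j'l] le_d.
    by rewrite /P le_d in nPm.
  by exists j'.
by move=> m'; rewrite mem_filter mcoeff_msupp => /andP[].
Qed.

Lemma veronese_depth : has_depth V n.
Proof.
split; last by move=> s _; apply: veronese_regular_leq.
exists [seq 'X_(y j) | j <- enum 'I_n]; split; last by rewrite size_map size_enum_ord.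
  by move=> f /mapP[j _ ->]; rewrite /irrelevant mcoeffX mnm1_eq0.
split=> [i|].
  rewrite size_map size_enum_ord => lt_in x; pose j := Ordinal lt_in.
  rewrite (nth_map j) ?size_enum_ord // -map_take.
  have -> : nth j (enum 'I_n) i = j by apply: val_inj; rewrite /= nth_enum_ord.
  move=> /in_pure_powers_mul xj; apply/in_pure_powers_mul => m mx.
  (* If x_j^d x^m is divisible by the d-th power of an earlier variable, then so is x^m. *)
  have [|j' j'l] := xj (U_(j) *+ d + m)%MM.
    rewrite veronese_valZ veronese_mapX ay mulrC (perm_mem (msuppMX _ _)).
    exact: map_f.
  rewrite mnmDE mulmnE mnm1E; case: eqP => [E|_]; last by rewrite mul0n; exists j'.
  move: j'l; rewrite -E => /(map_f val); rewrite map_take val_enum_ord take_iota.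
  by rewrite mem_iota /= add0n (minn_idPl (ltnW lt_in)) ltnn.
have [x Ex] := veronese_exists_pow K k a n_gt0; exists x => /in_pure_powers_mul.
move=> /(_ (U_(Ordinal n_gt0) *+ k)%MM); rewrite Ex msuppX mem_head => /(_ isT)[j _].
rewrite mulmnE leqNgt; apply/negP/negPn; apply: leq_ltn_trans lt_kd.
by rewrite mnm1E; case: eqP; rewrite ?mul1n ?mul0n.
Qed.

End SmallShift.

Section LargeShift.
Hypothesis le_dk : (d <= k)%N.

Lemma pow_notin_veronese (x : V) : veronese_val x <> 'X_[U_(Ordinal n_gt0) *+ (k - d)].
Proof.
move=> Ex; have [|i] := @veronese_val_deg _ _ _ _ _ x (U_(Ordinal n_gt0) *+ (k - d))%MM.
  by rewrite Ex msuppX mem_head.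
rewrite mdegMn mdeg1 mul1n => E; have : (k - d < k)%N.
  by rewrite ltn_subrL d_gt0 (leq_trans d_gt0 le_dk).
by rewrite E ltnNge leq_addr.
Qed.

Lemma veronese_mul_pow f : irrelevant f ->
  exists x : V, veronese_val x = phi f * 'X_[U_(Ordinal n_gt0) *+ (k - d)].
Proof.
move=> f0; have pV : phi f * 'X_[U_(Ordinal n_gt0) *+ (k - d)] \in veronese_pred d k.
  rewrite [f]mpolyE (raddf_sum (veronese_map a)) mulr_suml big_seq.
  apply: rpred_sum => m mf /=; have [m' m'd Em] := veronese_mapXm K a m.
  rewrite veronese_mapZ Em -scalerAl -mpolyXD.
  (* For e = [mdeg m] > 0 the degree is e d + (k - d) = k + (e - 1) d. *)
  apply: (@veronese_pred_monomial _ _ _ _ _ _ (mdeg m).-1).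
  rewrite mdegD m'd mdegMn mdeg1 mul1n.
  have : (0 < mdeg m)%N.
    rewrite lt0n mdeg_eq0; apply: contraTneq mf => ->.
    by rewrite mcoeff_msupp f0 eqxx.
  by case: (mdeg m) => // e _; rewrite mulSn -addnA addnCA subnKC // addnC.
by exists (Veronese pV).
Qed.

Lemma veronese_regular_leq1 (s : seq R) : (forall f, f \in s -> irrelevant f) ->
  is_regular_seq V s -> (size s <= 1)%N.
Proof.
case: s => [//|f [//|g s]] s0 [regs [x xV]]; exfalso.
(* If phi f = 0, then f x = 0, and regularity of f gives x = 0, which lies in s V. *)
have f0 : phi f != 0.
  apply/eqP => fE; apply: xV; apply: (@in_ideal_mul_sub _ _ [::]) => //.
  apply: (regs 0%N) => //=; apply/in_ideal_mul_nil/veronese_val_inj.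
  by rewrite veronese_valZ fE mul0r.
have [fz Efz] := veronese_mul_pow (s0 f (mem_head _ _)).
have [|gz Egz] := @veronese_mul_pow g; first by apply: s0; rewrite !inE eqxx orbT.
have /in_ideal_mul_cons[] : in_ideal_mul [:: f] fz.
  apply: (regs 1%N isT fz).
  rewrite /=; apply/in_ideal_mul_cons; exists gz; apply/in_ideal_mul_nil/veronese_val_inj.
  by rewrite veronese_valB !veronese_valZ Efz Egz mulrCA subrr.
move=> w /in_ideal_mul_nil/(congr1 (@veronese_val _ _ _ _)).
rewrite veronese_valB veronese_valZ Efz -mulrBr => /eqP.
rewrite mulf_eq0 (negPf f0) subr_eq0 => /eqP/esym; exact: pow_notin_veronese.
Qed.

End LargeShift.
End VeroneseDepth.

(** * Resolution and projective dimension of the Veronese module *)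

Section VeroneseResolution.
Context (K : fieldType) (n d k : nat) (a : degree_enum n d).
Hypothesis d_gt0 : (0 < d)%N.
Local Notation S := {mpoly K[n]}.
Local Notation R := {mpoly K[nvars n d]}.
Local Notation V := (veronese_module K k a).
Local Notation phi := (@veronese_map K n d a).

Let r := #|[pred m : 'X_{1..n < k.+1} | mdeg m == k]|.
Let mon (j : 'I_r) : 'X_{1..n} := val (enum_val j).

Let mon_deg j : mdeg (mon j) = k.
Proof. by apply/eqP; have := enum_valP j; rewrite inE. Qed.

Let mon_inj : injective mon.
Proof. by move=> i j /val_inj/enum_val_inj. Qed.

Let mon_surj m : mdeg m = k -> exists j, mon j = m.
Proof.
move=> Em; have lt_m : (mdeg m < k.+1)%N by rewrite Em.
have mP : BMultinom lt_m \in [pred m : 'X_{1..n < k.+1} | mdeg m == k].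
  by rewrite inE /= Em eqxx.
by exists (enum_rank_in mP (BMultinom lt_m)); rewrite /mon enum_rankK_in.
Qed.

(* V is generated by the monomials of degree k. *)
Lemma veronese_resolution_ex :
  exists (F : free_sequence K (nvars n d)) (e : 'I_(rank F 0) -> V),
    is_minimal_graded_free_resolution (@veronese_gr K n d k a) e.
Proof.
have ex_e j : exists x : V, veronese_val x = 'X_[mon j].
  by apply: (@veronese_monomial _ _ _ _ _ _ 0); rewrite mon_deg addn0.
have [e eE] := fin_all_exists ex_e.
pose aug (u : 'rV[R]_r) := \sum_(j < r) u 0 j *: e j.
have augE u : veronese_val (aug u) = \sum_(j < r) phi (u 0 j) * 'X_[mon j].
  by rewrite veronese_val_sum; apply: eq_bigr => j _; rewrite veronese_valZ eE.
(* R-degree t corresponds to degree k + t d in S, so homogeneous components of relations are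
   relations. *)
have hcomp_aug t u :
    hcomp (t * d%:Z + k%:Z) (veronese_val (aug u)) =
    \sum_(j < r) phi (hcomp t (u 0 j)) * 'X_[mon j].
  rewrite augE raddf_sum; apply: eq_bigr => j _.
  rewrite -hcomp_veronese_map //; apply: hcompM => m.
  by rewrite msuppX inE => /eqP->; rewrite mon_deg.
apply: (@minimal_resolution_ex _ _ _ _ r (fun _ => 0) e) => [j m|x|t u uK|u uK j].
- by rewrite eE msuppX inE => /eqP->; rewrite mon_deg mul0r addr0.
- suff [u Eu] : exists u, veronese_val (aug u) = veronese_val x.
    by exists u; apply: veronese_val_inj.
  rewrite [veronese_val x]mpolyE big_seq.
  apply: (big_ind (fun p => exists u, veronese_val (aug u) = p)).
  + by exists 0; rewrite augE big1 // => j _; rewrite mxE rmorph0 mul0r.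
  + move=> _ _ [u <-] [v <-]; exists (u + v); rewrite !augE -big_split.
    by apply: eq_bigr => j _; rewrite mxE rmorphD mulrDl.
  move=> m /veronese_val_deg[i Em].
  have [|m1 [m2 [E m1k]]] := @mon_split n k m; first by rewrite Em leq_addr.
  have [j Ej] := mon_surj m1k.
  have [|f fE] := @veronese_map_monomial K n d a i m2.
    by apply/eqP; rewrite -(eqn_add2l k) -{1}m1k -mdegD -E Em.
  exists (((veronese_val x)@_m *: f) *: delta_mx 0 j).
  rewrite augE (bigD1 j) //= big1 => [|j' /negPf ne]; last first.
    by rewrite !mxE ne andbF mulr0 rmorph0 mul0r.
  by rewrite !mxE !eqxx mulr1 addr0 veronese_mapZ fE -scalerAl Ej -mpolyXD addmC -E.
- apply: veronese_val_inj; rewrite -/(aug _) augE veronese_val0.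
  transitivity (hcomp (t * d%:Z + k%:Z) (veronese_val (aug u))).
    by rewrite hcomp_aug; apply: eq_bigr => j _; rewrite mxE subr0.
  by rewrite /aug uK veronese_val0 raddf0.
(* In degree k a relation only involves the constant terms of its entries, as coefficients of
   distinct monomials, so they vanish. *)
have := hcomp_aug 0 u; rewrite /aug uK veronese_val0 raddf0.
under eq_bigr do rewrite irrelevant_hcomp0 veronese_mapC mul_mpolyC.
move=> /esym/(congr1 (mcoeff (mon j))); rewrite raddf_sum mcoeff0 (bigD1 j) //=.
rewrite mcoeffZ mcoeffX eqxx mulr1 big1 ?addr0 // => i /negPf ne.
by rewrite mcoeffZ mcoeffX (inj_eq mon_inj) ne mulr0.
Qed.

Lemma veronese_maximal_pdim (n_gt0 : (0 < n)%N) : (d <= k)%N ->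
  has_pdim (@veronese_gr K n d k a) (nvars n d).-1.
Proof.
move=> le_dk; have [F [e resF]] := veronese_resolution_ex.
exists F, e; split=> //.
have irrX (l : 'I_(nvars n d)) : irrelevant ('X_l : R).
  by rewrite /irrelevant mcoeffX mnm1_eq0.
have N_gt0 : (0 < nvars n d)%N.
  have [l _] := pure_power_ex a (Ordinal n_gt0).
  exact: leq_trans (ltn_ord l).
pose j := Ordinal N_gt0.
(* If z were in X_j V, cancelling the image of X_j in S would put x_1^(k-d) in V. Moreover X_l z is
   X_j times the element X_l x_1^(k-d) of V. *)
have [z Ez] := veronese_mul_pow a n_gt0 le_dk (irrX j).
have phiX0 l : phi 'X_l != 0 by rewrite veronese_mapX mpolyX_neq0.
apply: (maximal_pdim (j := j) (z := z) _ resF) => // [x /(congr1 (@veronese_val _ _ _ _))|x|l].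
- rewrite veronese_valZ => /eqP; rewrite mulf_eq0 (negPf (phiX0 j)) => /eqP xE.
  exact: veronese_val_inj.
- move=> /(congr1 (@veronese_val _ _ _ _)); rewrite veronese_valZ Ez => /eqP.
  rewrite -subr_eq0 -mulrBr mulf_eq0 (negPf (phiX0 j)) subr_eq0 => /eqP/esym.
  exact: pow_notin_veronese.
have [x Ex] := veronese_mul_pow a n_gt0 le_dk (irrX l).
by exists x; apply: veronese_val_inj; rewrite !veronese_valZ Ez Ex mulrCA.
Qed.

End VeroneseResolution.

Theorem theorem3p5 (K : fieldType) (n d k : nat) (a : degree_enum n d)
    (hn : (1 < n)%N) (hd : (0 < d)%N) :
  (cohen_macaulay (veronese_module K k a) <-> (k < d)%N) /\
  (~ cohen_macaulay (veronese_module K k a) ->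
     has_pdim (@veronese_gr K n d k a) ('C(d + n - 1, d) - 1)%N).
Proof.
have n_gt0 : (0 < n)%N by apply: ltnW.
have CM_lt : (k < d)%N -> cohen_macaulay (veronese_module K k a).
  move=> lt_kd; exists n; split; last exact: veronese_krull_dim.
  have [y ay] := fin_all_exists (pure_power_ex a).
  exact: (veronese_depth K n_gt0 lt_kd ay).
split.
  (* For d <= k, the length of s would equal the dimension and so be at least n, but it is at most 1
     < n. *)
  split=> // -[r [[[s [s_irr regs <-]] _] [_ dim_le]]].
  rewrite ltnNge; apply/negP => le_dk.
  have := dim_le _ _ (veronese_support_chain K k a n_gt0 hd).
  rewrite leqNgt => /negP; apply; apply: leq_ltn_trans hn.
  exact: (veronese_regular_leq1 n_gt0 hd le_dk s_irr regs).
move=> nCM; rewrite subn1; apply: veronese_maximal_pdim => //.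
by rewrite leqNgt; apply/negP => /CM_lt.
Qed.
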